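(* Let $N\ge5$. Let $U$ be a random $N\times N$ unitary matrix whose spectrum is almost surely simple, and let $v$ be a random unit vector, independent of $U$, distributed with a non-vanishing density on the unit sphere $\mathbb{S}_{N-1}(\mathbb{C})$ of $\mathbb{C}^N$. For $t\in(-1,1)$ let $\lambda_1(t),\dots,\lambda_N(t)$ be the eigenvalues (counted with multiplicity) of $G(t)=U\,(I_N-(1-t)vv^* )$. Then the trajectories of the eigenvalues almost surely do not intersect, i.e. $$\mathbb{P}\Big(\exists\, s,t\in(-1,1),\ \exists\, i,j\in\{1,\dots,N\}:\ (s,i)\neq(t,j),\ \lambda_i(s)=\lambda_j(t)\Big)=0.$$
   Context: $\mathbb{S}_{N-1}(\mathbb{C})$ denotes the set of unit vectors in $\mathbb{C}^N$; the density is with respect to the uniform measure on this sphere. *)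

(* Defs.v *)
From HB Require Import structures.
From mathcomp Require Import all_boot all_order all_algebra.
From mathcomp Require Import complex.
From mathcomp Require Import all_classical all_reals all_analysis.
From mathcomp Require Import measurable_realfun.

Set Implicit Arguments.
Unset Strict Implicit.
Unset Printing Implicit Defensive.
Set SsrOldRewriteGoalsOrder.

Import Order.TTheory GRing.Theory Num.Theory.
Import numFieldNormedType.Exports.

Local Open Scope classical_set_scope.
Local Open Scope ring_scope.
Local Open Scope sesquilinear_scope.

HB.instance Definition _ (R : realType) := isPointed.Build R[i] 0.

(* The sigma-algebra generated by the real and imaginary parts, i.e. the Borel
   sigma-algebra of C = R^2. *)
Definition complex_display : measure_display.
Proof. exact: default_measure_display. Qed.

Section complex_measurable.
Context {R : realType}.

Definition complex_measurable : set (set R[i]) :=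
  g_sigma_preimageU (@complex.Re R) (@complex.Im R).

Let complex_measurable0 : complex_measurable set0.
Proof. exact: sigma_algebra0. Qed.

Let complex_measurableC A : complex_measurable A -> complex_measurable (~` A).
Proof. exact: sigma_algebraC. Qed.

Let complex_measurable_bigcup (F : (set R[i])^nat) :
  (forall k, complex_measurable (F k)) -> complex_measurable (\bigcup_k F k).
Proof. exact: sigma_algebra_bigcup. Qed.

HB.instance Definition _ := @isMeasurable.Build complex_display R[i]
  complex_measurable complex_measurable0 complex_measurableC
  complex_measurable_bigcup.

Lemma measurable_ReIm : measurable_fun [set: R[i]] (@complex.Re R) /\
  measurable_fun [set: R[i]] (@complex.Im R).
Proof.
split=> _ A mA; apply: sub_sigma_algebra; [left|right]; by exists A.
Qed.

Lemma measurable_complexP d (T : measurableType d) (f : T -> R[i]) :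
  measurable_fun [set: T] f <->
  measurable_fun [set: T] (@complex.Re R \o f) /\
  measurable_fun [set: T] (@complex.Im R \o f).
Proof.
have [mRe mIm] := measurable_ReIm.
split=> [mf|[mf1 mf2]]; first by split; exact: measurableT_comp.
apply: (@measurability _ _ _ _ _ f _ erefl) => B [C [[A mA <-]|[A mA <-]] <-].
  by rewrite [X in measurable (_ `&` f @^-1` X)]setTI -comp_preimage; exact: mf1.
by rewrite [X in measurable (_ `&` f @^-1` X)]setTI -comp_preimage; exact: mf2.
Qed.

End complex_measurable.

(* The product sigma-algebra generated by the entries; over C this is the Borel
   sigma-algebra of the finite-dimensional space of matrices. *)
Definition matrix_display : measure_display -> measure_display.
Proof. exact. Qed.

Section matrix_measurable.
Context d (T : measurableType d) (m n : nat).

Definition matrix_gen : set (set 'M[T]_(m, n)) :=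
  \bigcup_(ij in [set: 'I_m * 'I_n])
    preimage_set_system setT (fun M : 'M[T]_(m, n) => M ij.1 ij.2) measurable.

Definition matrix_measurable := <<s matrix_gen >>.

Let matrix_measurable0 : matrix_measurable set0.
Proof. exact: sigma_algebra0. Qed.

Let matrix_measurableC A : matrix_measurable A -> matrix_measurable (~` A).
Proof. exact: sigma_algebraC. Qed.

Let matrix_measurable_bigcup (F : (set 'M[T]_(m, n))^nat) :
  (forall k, matrix_measurable (F k)) -> matrix_measurable (\bigcup_k F k).
Proof. exact: sigma_algebra_bigcup. Qed.

HB.instance Definition _ := @isMeasurable.Build (matrix_display d)
  'M[T]_(m, n) matrix_measurable matrix_measurable0 matrix_measurableC
  matrix_measurable_bigcup.

Lemma measurable_mxE i j :
  measurable_fun [set: 'M[T]_(m, n)] (fun M : 'M[T]_(m, n) => M i j).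
Proof.
by move=> _ A mA; apply: sub_sigma_algebra; exists (i, j) => //; exists A.
Qed.

Lemma measurable_mxP d' (S : measurableType d') (f : S -> 'M[T]_(m, n)) :
  measurable_fun [set: S] f <->
  forall i j, measurable_fun [set: S] (fun s => f s i j).
Proof.
split=> [mf i j|mf].
  exact: (measurableT_comp (measurable_mxE i j) mf).
apply: (@measurability _ _ _ _ _ f _ erefl) => B [C [[i j] _ [A mA <-]] <-].
rewrite [X in measurable (_ `&` f @^-1` X)]setTI -comp_preimage.
exact: mf.
Qed.

End matrix_measurable.

Section image_measure.
Context d d' (T1 : measurableType d) (T2 : measurableType d') (R : realType).
Variables (m : {measure set T1 -> \bar R}) (f : {mfun T1 >-> T2}).

Definition image_measure := pushforward m f.

Let image_measure0 : image_measure set0 = 0%E.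
Proof. exact: measure0. Qed.

Let image_measure_ge0 A : (0 <= image_measure A)%E.
Proof. exact: measure_ge0. Qed.

Let image_measure_sigma_additive : semi_sigma_additive image_measure.
Proof. exact: measure_semi_sigma_additive. Qed.

HB.instance Definition _ := isMeasure.Build _ _ _ image_measure
  image_measure0 image_measure_ge0 image_measure_sigma_additive.

End image_measure.

(* The n-dimensional Lebesgue measure, as an iterated product of
   lebesgue_measure; its factors live on measurableTypeR R, the carrier on which
   lebesgue_measure is declared. *)
Section lebesgue_tuple.
Context {R : realType}.

Definition tuple_cons n (p : measurableTypeR R * n.-tuple (measurableTypeR R)) : n.+1.-tuple (measurableTypeR R) :=
  [tuple of p.1 :: p.2].

Lemma measurable_tuple_cons n : measurable_fun setT (@tuple_cons n).
Proof. exact: measurable_cons. Qed.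

HB.instance Definition _ n :=
  @isMeasurableFun.Build _ _ _ _ (@tuple_cons n) (@measurable_tuple_cons n).

Section lebesgue_cons.
Variables (n : nat) (mu : {sigma_finite_measure set (n.-tuple (measurableTypeR R)) -> \bar R}).

Definition lebesgue_cons : set (n.+1.-tuple (measurableTypeR R)) -> \bar R :=
  image_measure (@lebesgue_measure R \x mu)%E (@tuple_cons n).

HB.instance Definition _ := Measure.on lebesgue_cons.

Let lebesgue_cons_sigma_finite : sigma_finite setT lebesgue_cons.
Proof.
have /sigma_finiteP[F [TF ndF Foo]] := sigma_finiteT (@lebesgue_measure R).
have /sigma_finiteP[G [TG ndG Goo]] := sigma_finiteT mu.
pose g (t : n.+1.-tuple (measurableTypeR R)) : measurableTypeR R * n.-tuple (measurableTypeR R) := (thead t, [tuple of behead t]).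
have gK : cancel (@tuple_cons n) g.
  by move=> [x t]; rewrite /g theadE; congr pair; exact/val_inj.
have mg : measurable_fun setT g.
  apply: measurable_fun_pair; last exact: measurable_behead.
  exact: measurable_tnth.
exists (fun k => g @^-1` (F k `*` G k)).
  rewrite -preimage_bigcup -[LHS](preimage_setT g); congr (_ @^-1` _).
  rewrite -setXTT TF TG; apply/seteqP; split => -[x t].
    move=> [/= [k _ Fkx] [l _ Glt]]; exists (maxn k l) => //; split.
    - by move: x Fkx; exact/subsetPset/ndF/leq_maxl.
    - by move: t Glt; exact/subsetPset/ndG/leq_maxr.
  by move=> [k _ [/= Fkx Gkt]]; split; exists k.
move=> k; have [mF Fk] := Foo k; have [mG Gk] := Goo k.
split; first by rewrite -[X in measurable X]setTI; apply: mg => //; exact: measurableX.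
rewrite /lebesgue_cons /image_measure /pushforward -comp_preimage.
rewrite (_ : g \o _ = id); last by apply/funext => p /=; exact: gK.
rewrite preimage_id.
rewrite [X in (X < _)%E](product_measure1E (@lebesgue_measure R) mu mF mG).
by rewrite lte_mul_pinfty// ge0_fin_numE.
Qed.

HB.instance Definition _ :=
  Measure_isSigmaFinite.Build _ _ _ lebesgue_cons lebesgue_cons_sigma_finite.

End lebesgue_cons.

Fixpoint lebesgue_tuple n : {sigma_finite_measure set (n.-tuple (measurableTypeR R)) -> \bar R} :=
  match n return {sigma_finite_measure set (n.-tuple (measurableTypeR R)) -> \bar R} with
  | 0 => @dirac _ (0.-tuple (measurableTypeR R)) [tuple] R
  | k.+1 => lebesgue_cons (lebesgue_tuple k)
  end.

Definition tuple_box (n : nat) (a : R) : set (n.-tuple (measurableTypeR R)) :=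
  [set t | forall j, `|tnth t j : R| <= a].

Arguments tuple_box : clear implicits.

Lemma lebesgue_tuple_box (n : nat) (a : R) : 0 <= a ->
  measurable (tuple_box n a) /\
  lebesgue_tuple n (tuple_box n a) = ((2 * a) ^+ n)%:E.
Proof.
move=> a0.
have lI : @lebesgue_measure R `[- a, a] = (2 * a)%:E.
  rewrite lebesgue_measure_itv/= lte_fin; case: ltP => [_|].
    by rewrite -EFinB opprK mulr_natl mulr2n.
  move=> aN; have /eqP -> : a == 0; last by rewrite mulr0.
  by rewrite eq_le a0 andbT (le_trans aN)// oppr_le0.
have mB k : measurable (tuple_box k a).
  rewrite (_ : tuple_box k a = \bigcap_(j in [set: 'I_k])
      ((fun t : k.-tuple (measurableTypeR R) => tnth t j) @^-1` `[- a, a])).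
    apply: fin_bigcap_measurable => // j _.
    rewrite -[X in measurable X]setTI.
    exact: (measurable_tnth j).
  apply/seteqP; split => t /= H j; first by move=> _; rewrite /= in_itv/= -ler_norml.
  by have := H j Logic.I; rewrite /= in_itv/= -ler_norml.
split=> //; elim: n => [|n IH] /=.
  rewrite expr0 diracE mem_set//.
  by case.
rewrite /lebesgue_cons /image_measure /pushforward.
rewrite (_ : _ @^-1` _ = `[- a, a] `*` tuple_box n a); last first.
  apply/seteqP; split => -[x t] /=.
    move=> H; split; last by move=> j; have := H (lift ord0 j); rewrite tnthS.
    by have := H ord0; rewrite tnth0 in_itv/= -ler_norml.
  rewrite in_itv/= -ler_norml => -[Hx Ht] j.
  case: (unliftP ord0 j) => [k ->|->]; last by rewrite tnth0.
  by rewrite tnthS; exact: Ht.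
rewrite [LHS](product_measure1E (@lebesgue_measure R) (lebesgue_tuple n) _ (mB n)); last first.
  exact: measurable_itv.
rewrite [X in (_ * X)%E]IH.
by rewrite [X in (X * _)%E]lI exprS EFinM.
Qed.

End lebesgue_tuple.
Arguments tuple_box {R} n a.

Section sphere.
Context {R : realType} {n : nat}.

Definition cvec_of_ReIm (p : n.-tuple (measurableTypeR R) * n.-tuple (measurableTypeR R)) : 'cV[R[i]]_n :=
  \col_j Complex (tnth p.1 j) (tnth p.2 j).

Lemma measurable_cvec_of_ReIm : measurable_fun setT cvec_of_ReIm.
Proof.
apply/measurable_mxP => j k; apply/measurable_complexP; split.
  rewrite (_ : _ \o _ = (fun p => tnth p.1 j)); last first.
    by apply/funext => p /=; rewrite mxE.
  exact: (measurableT_comp (measurable_tnth j)).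
rewrite (_ : _ \o _ = (fun p => tnth p.2 j)); last first.
  by apply/funext => p /=; rewrite mxE.
exact: (measurableT_comp (measurable_tnth j)).
Qed.

HB.instance Definition _ :=
  @isMeasurableFun.Build _ _ _ _ cvec_of_ReIm measurable_cvec_of_ReIm.

(* Lebesgue measure on C^n = R^n * R^n. *)
Definition lebesgue_cvec : set 'cV[R[i]]_n -> \bar R :=
  image_measure (@lebesgue_tuple R n \x @lebesgue_tuple R n)%E cvec_of_ReIm.

HB.instance Definition _ := Measure.on lebesgue_cvec.

Definition enorm (x : 'cV[R[i]]_n) : R :=
  Num.sqrt (\sum_i (complex.Re (x i 0) ^+ 2 + complex.Im (x i 0) ^+ 2)).

Lemma measurable_enorm : measurable_fun setT enorm.
Proof.
have [mRe mIm] := @measurable_ReIm R.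
apply: (@measurableT_comp _ _ _ _ _ _ (@Num.sqrt R)).
  by apply: continuous_measurable_fun; exact: sqrt_continuous.
apply: measurable_sum => i; apply: measurable_funD; apply: measurable_funX.
  exact: (measurableT_comp mRe (measurable_mxE i 0)).
exact: (measurableT_comp mIm (measurable_mxE i 0)).
Qed.

Definition unit_sphere : set 'cV[R[i]]_n := [set x | enorm x = 1].

Definition unit_ball : set 'cV[R[i]]_n := [set x | enorm x <= 1].

Lemma measurable_unit_ball : measurable unit_ball.
Proof.
rewrite (_ : unit_ball = setT `&` enorm @^-1` `]-oo, 1]).
  by apply: measurable_enorm => //; exact: measurable_itv.
by apply/seteqP; split => x /=; rewrite in_itv //= => -[].
Qed.

(* radial_proj 0 = 0; elsewhere radial_proj x lies on the unit sphere. *)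
Definition radial_proj (x : 'cV[R[i]]_n) : 'cV[R[i]]_n :=
  real_complex R (enorm x)^-1 *: x.

Lemma measurable_radial_proj : measurable_fun setT radial_proj.
Proof.
have [mRe mIm] := @measurable_ReIm R.
have mV : measurable_fun setT (fun x : 'cV[R[i]]_n => (enorm x)^-1).
  rewrite (_ : (fun _ => _) = (@powR R ^~ (-1)) \o enorm); last first.
    by apply/funext => x /=; rewrite powR_inv1// sqrtr_ge0.
  exact: (measurableT_comp (measurable_powR _) measurable_enorm).
apply/measurable_mxP => j k; apply/measurable_complexP; split.
  rewrite (_ : _ \o _ =
    (fun x : 'cV[R[i]]_n => (enorm x)^-1 * complex.Re (x j k))).
    apply: measurable_funM => //.
    exact: (measurableT_comp mRe (measurable_mxE j k)).
  by apply/funext => x /=; rewrite mxE; case: (x j k) => a b /=; rewrite mul0r subr0.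
rewrite (_ : _ \o _ =
  (fun x : 'cV[R[i]]_n => (enorm x)^-1 * complex.Im (x j k))).
  apply: measurable_funM => //.
  exact: (measurableT_comp mIm (measurable_mxE j k)).
by apply/funext => x /=; rewrite mxE; case: (x j k) => a b /=; rewrite mul0r addr0.
Qed.

HB.instance Definition _ :=
  @isMeasurableFun.Build _ _ _ _ radial_proj measurable_radial_proj.

Definition cvec_box (a : R) : set 'cV[R[i]]_n :=
  [set x | forall j, `|complex.Re (x j 0)| <= a /\ `|complex.Im (x j 0)| <= a].

Lemma measurable_cvec_box (a : R) : measurable (cvec_box a).
Proof.
have [mRe mIm] := @measurable_ReIm R.
rewrite (_ : cvec_box a = \bigcap_(j in [set: 'I_n])
   ((fun x : 'cV[R[i]]_n => complex.Re (x j 0)) @^-1` `[- a, a] `&`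
    (fun x : 'cV[R[i]]_n => complex.Im (x j 0)) @^-1` `[- a, a])).
  apply: fin_bigcap_measurable => // j _; apply: measurableI.
    rewrite -[X in measurable X]setTI.
    exact: (measurableT_comp mRe (measurable_mxE j 0)).
  rewrite -[X in measurable X]setTI.
  exact: (measurableT_comp mIm (measurable_mxE j 0)).
apply/seteqP; split => x /= H j.
  by move=> _; have [] := H j; rewrite /= !in_itv/= -!ler_norml.
by have [] := H j Logic.I; rewrite /= !in_itv/= -!ler_norml.
Qed.

Lemma lebesgue_cvec_box (a : R) : 0 <= a ->
  lebesgue_cvec (cvec_box a) =
  ((2 * a) ^+ n * (2 * a) ^+ n)%:E.
Proof.
move=> a0; have [mB lB] := lebesgue_tuple_box n a0.
rewrite /lebesgue_cvec /image_measure /pushforward.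
rewrite (_ : _ @^-1` _ = tuple_box n a `*` tuple_box n a); last first.
  apply/seteqP; split => -[x y] /=.
    by move=> H; split=> j; have := H j; rewrite mxE => -[].
  by move=> [Hx Hy] j; rewrite mxE; split; [exact: Hx|exact: Hy].
rewrite [LHS](product_measure1E (lebesgue_tuple n) (lebesgue_tuple n) mB mB).
by rewrite EFinM -lB.
Qed.

Lemma lebesgue_unit_ball_fin :
  (0 < lebesgue_cvec unit_ball)%E /\ (lebesgue_cvec unit_ball < +oo)%E.
Proof.
split.
  pose a : R := (2 * n + 1)%:R^-1.
  have a0 : 0 < a by rewrite invr_gt0 ltr0n addn1.
  apply: (@lt_le_trans _ _ ((2 * a) ^+ n * (2 * a) ^+ n)%:E).
    by rewrite lte_fin mulr_gt0// exprn_gt0// mulr_gt0.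
  rewrite -(lebesgue_cvec_box (ltW a0)); apply: le_measure; rewrite ?inE.
  - exact: measurable_cvec_box.
  - exact: measurable_unit_ball.
  move=> x /= H; rewrite /unit_ball /= /enorm -sqrtr1 ler_sqrt//.
  have a1 : a <= 1 by rewrite invf_le1 ?ltr0n ?addn1// ler1n.
  have sq (y : R) : `|y| <= a -> y ^+ 2 <= a.
    move=> ya; rewrite -real_normK ?num_real// expr2.
    by rewrite -[leRHS]mulr1 ler_pM// (le_trans ya).
  apply: (@le_trans _ _ (\sum_(i < n) (a + a))).
    by apply: ler_sum => i _; have [/sq ? /sq ?] := H i; exact: lerD.
  rewrite sumr_const card_ord -mulr2n -mulrnA -mulr_natl.
  by rewrite ler_pdivrMr ?ltr0n ?addn1// mul1r ler_nat leqW.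
apply: (@le_lt_trans _ _ ((2 * 1) ^+ n * (2 * 1) ^+ n)%:E); last exact: ltry.
rewrite -(lebesgue_cvec_box ler01); apply: le_measure; rewrite ?inE.
- exact: measurable_unit_ball.
- exact: measurable_cvec_box.
move=> x /= ; rewrite /unit_ball /= /enorm -[X in _ <= X -> _]sqrtr1 ler_sqrt// => H j.
have sq (y : R) : y ^+ 2 <= 1 -> `|y| <= 1.
  by rewrite -[in X in X -> _]real_normK ?num_real// expr_le1.
have {}H : complex.Re (x j 0) ^+ 2 + complex.Im (x j 0) ^+ 2 <= 1.
  apply: le_trans H; rewrite (bigD1 j)//= lerDl sumr_ge0// => i _.
  by rewrite addr_ge0// sqr_ge0.
split; apply: sq; apply: le_trans H; first by rewrite lerDl sqr_ge0.
by rewrite lerDr sqr_ge0.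
Qed.

(* mnormalize needs a default probability for measures of total mass 0 or +oo;
   it is not used here by lebesgue_unit_ball_fin, see uniform_sphereE. *)
Definition uniform_ball : probability 'cV[R[i]]_n R :=
  mnormalize (mrestr lebesgue_cvec measurable_unit_ball)
    (@dirac _ 'cV[R[i]]_n 0 R).

(* The normalized surface measure of the sphere: a subset A of the sphere has mass
   vol {r x | 0 <= r <= 1, x in A} / vol (unit ball). *)
Definition uniform_sphere : probability 'cV[R[i]]_n R :=
  distribution uniform_ball radial_proj.

Lemma uniform_sphereE (A : set 'cV[R[i]]_n) :
  uniform_sphere A = (lebesgue_cvec (radial_proj @^-1` A `&` unit_ball) *
    (fine (lebesgue_cvec unit_ball))^-1%:E)%E.
Proof.
have [B0 Boo] := lebesgue_unit_ball_fin.
rewrite /uniform_sphere /distribution /pushforward /uniform_ball /=.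
pose mu := mrestr lebesgue_cvec measurable_unit_ball.
have muT : mu setT = lebesgue_cvec unit_ball by exact: (congr1 lebesgue_cvec (setTI _)).
change ((if (mu setT == 0%E) || (mu setT == +oo%E) then (fun U => @dirac _ 'cV[R[i]]_n 0 R U)
  else fun U => (mu U * (fine (mu setT))^-1%:E)%E) (radial_proj @^-1` A) =
  (lebesgue_cvec (radial_proj @^-1` A `&` unit_ball) *
    (fine (lebesgue_cvec unit_ball))^-1%:E)%E).
rewrite muT ifF//.
by apply/negbTE; rewrite negb_or gt_eqF// lt_eqF.
Qed.

Lemma measurable_unit_sphere : measurable unit_sphere.
Proof.
rewrite (_ : unit_sphere = setT `&` enorm @^-1` [set 1]).
  by apply: measurable_enorm.
by rewrite setTI.
Qed.

Lemma uniform_sphere_unit_sphere : (0 < n)%N -> uniform_sphere unit_sphere = 1%E.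
Proof.
move=> n0; rewrite -[unit_sphere]setCK probability_setC; last first.
  by apply: measurableC; exact: measurable_unit_sphere.
rewrite uniform_sphereE (_ : lebesgue_cvec _ = 0%E) ?mul0e ?sube0//.
have /= box0 := lebesgue_cvec_box (lexx 0).
rewrite mulr0 expr0n eqn0Ngt n0 mulr0 in box0.
apply: (@subset_measure0 _ _ _ lebesgue_cvec _ _ _ (measurable_cvec_box 0) _ box0).
  apply: measurableI; last exact: measurable_unit_ball.
  rewrite -[X in measurable X]setTI; apply: measurable_radial_proj => //.
  by apply: measurableC; exact: measurable_unit_sphere.
move=> x [/= H _].
have [x0 j|x0] := eqVneq (enorm x) 0; last first.
  exfalso; apply: H; rewrite /unit_sphere /=.
  have -> : enorm (radial_proj x) = Num.sqrt (((enorm x)^-1) ^+ 2 *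
      \sum_i (complex.Re (x i 0) ^+ 2 + complex.Im (x i 0) ^+ 2)).
    rewrite {1}/enorm mulr_sumr; congr Num.sqrt; apply: eq_bigr => i _.
    rewrite mxE; case: (x i 0) => a b /=.
    by rewrite !mul0r subr0 addr0 !exprMn mulrDr.
  rewrite sqrtrM ?sqr_ge0// sqrtr_sqr ger0_norm ?invr_ge0 ?sqrtr_ge0//.
  exact: mulVf.
have S0 : \sum_i (complex.Re (x i 0) ^+ 2 + complex.Im (x i 0) ^+ 2) = 0.
  apply/eqP; rewrite eq_le sumr_ge0 ?andbT => [|i _]; last by rewrite addr_ge0 ?sqr_ge0.
  by rewrite -sqrtr_eq0; exact/eqP.
have /eqP := @psumr_eq0P _ _ xpredT _ (fun i _ => addr_ge0 (sqr_ge0 _) (sqr_ge0 _)) S0 j isT.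
by rewrite paddr_eq0 ?sqr_ge0// !sqrf_eq0 => /andP[/eqP -> /eqP ->]; rewrite normr0.
Qed.

End sphere.

Section random_matrix.
Context {R : realType}.

(* l lists the eigenvalues of A with their algebraic multiplicities. *)
Definition eigenvalues_of n (A : 'M[R[i]]_n) (l : 'I_n -> R[i]) : Prop :=
  char_poly A = \prod_i ('X - (l i)%:P).

Definition simple_spectrum n (A : 'M[R[i]]_n) : Prop :=
  exists2 l : 'I_n -> R[i], eigenvalues_of A l & injective l.

Definition rank_one_path n (U : 'M[R[i]]_n) (v : 'cV[R[i]]_n) (t : R) :
    'M[R[i]]_n :=
  U *m (1%:M - (1 - t)%:C%C *: (v *m v^t*)).

Context d (Omega : measurableType d) (P : probability Omega R).

Definition independent_RVs d1 d2 (T1 : measurableType d1)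
    (T2 : measurableType d2) (X : {RV P >-> T1}) (Y : {RV P >-> T2}) : Prop :=
  forall (A : set T1) (B : set T2), measurable A -> measurable B ->
    P (X @^-1` A `&` Y @^-1` B) = (P (X @^-1` A) * P (Y @^-1` B))%E.

Definition has_nonvanishing_sphere_density n (v : {RV P >-> 'cV[R[i]]_n}) :
    Prop :=
  exists f : 'cV[R[i]]_n -> R,
    [/\ measurable_fun unit_sphere f,
        forall x, unit_sphere x -> 0 < f x &
        forall A : set 'cV[R[i]]_n, measurable A ->
          distribution P v A =
          (\int[uniform_sphere]_(x in A `&` unit_sphere) (f x)%:E)%E].

End random_matrix.

(* Main.v *)
Require Import Defs.
From HB Require Import structures.
From mathcomp Require Import all_boot all_order all_algebra.
From mathcomp Require Import complex.
From mathcomp Require Import all_classical all_reals all_analysis.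
From mathcomp Require Import measurable_realfun ring zify.

Set Implicit Arguments.
Unset Strict Implicit.
Unset Printing Implicit Defensive.

Import Order.TTheory GRing.Theory Num.Theory.
Import numFieldNormedType.Exports.

(* Write p for the characteristic polynomial of U and q for v^* adj(z - U) U v, so
   that U (1 - c v v^* ) has characteristic polynomial p + c q, with c = 1 - t.
   Two eigenvalues at distinct times coincide only at a common root of p and q,
   i.e. when v is orthogonal to an eigenvector of U. Two eigenvalues at the same
   time coincide only if D(r) = disc(r |v|^2 p + q) vanishes at the real number
   r = 1 / c; then D has a common root with its complex conjugate, so that their
   resultant F(U, v) vanishes. F is a polynomial in the real and imaginary parts
   of the coordinates of v, homogeneous under scaling, hence its zeros are
   negligible on the sphere as soon as F(U, .) is not identically zero; by Fubini
   and independence this suffices.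
   To see that F(U, .) <> 0, take v = sqrt(w1) e1 + sqrt(w2) e2, with e1, e2
   eigenvectors for u1 <> - u2 and w1 + w2 = 1, w1 <> w2. The double roots of
   r p + q are then explicit: they come from a quadratic polynomial, whose
   discriminant cannot vanish at both r and r^* , or from the other eigenvalues,
   which forces Re r = 1/2; the remaining coincidences are avoided by choosing w1
   outside a finite set. *)

Local Open Scope ring_scope.
Local Open Scope sesquilinear_scope.

(** * Sylvester matrices of fixed size *)

(* The entries do not depend on the sizes of p and q, unlike Sylvester_mx. *)
Definition sylvester (R : nzRingType) m n (p q : {poly R}) : 'M[R]_(n + m) :=
  col_mx (\matrix_(i < n, j < n + m) ('X^i * p)`_j)
         (\matrix_(i < m, j < n + m) ('X^i * q)`_j).

(** For p and q of degrees at most m and n, a left kernel vector is thus a relation a p + b q = 0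
    with deg a < n and deg b < m. *)
Lemma mul_row_sylvester (R : comNzRingType) m n (p q : {poly R}) a b :
  row_mx a b *m sylvester m n p q = poly_rV (rVpoly a * p + rVpoly b * q).
Proof.
have rVE d (u : 'rV[R]_d) (s : {poly R}) k :
    (rVpoly u * s)`_k = \sum_i u 0 i * ('X^i * s)`_k.
  rewrite /rVpoly poly_def mulr_suml coef_sum; apply: eq_bigr => i _.
  by rewrite valK -scalerAl coefZ.
rewrite mul_row_col; apply/rowP => j; rewrite !mxE coefD !rVE.
by congr (_ + _); apply: eq_bigr => i _; rewrite !mxE.
Qed.

(** A common root z puts the column of powers of z in the right kernel; its first entry z^0 = 1
    shows that it is nonzero. *)
Lemma sylvester_root (F : fieldType) m n (p q : {poly F}) z :
  (0 < n + m)%N -> (size p <= m.+1)%N -> (size q <= n.+1)%N ->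
  root p z -> root q z -> \det (sylvester m n p q) = 0.
Proof.
move=> nm0 sp sq /rootP pz /rootP qz.
have S0 : sylvester m n p q *m \col_(j < n + m) z ^+ j = 0.
  apply/colP => i; rewrite /sylvester mul_col_mx !mxE.
  have hE k (s : {poly F}) : (k + size s <= n + m)%N -> s.[z] = 0 ->
      \sum_(j < n + m) ('X^k * s)`_j * z ^+ j = 0.
    move=> sk sz; rewrite -(@horner_coef_wide _ (n + m)) ?hornerM ?sz ?mulr0//.
    by rewrite (leq_trans (size_polyMleq _ _))// size_polyXn addSn.
  case: (fintype.split i) => k; rewrite mxE; under eq_bigr => j _ do rewrite !mxE.
    by apply: hE => //; have := ltn_ord k; lia.
  by apply: hE => //; have := ltn_ord k; lia.
apply/eqP; rewrite -[_ == _]negbK; apply/negP.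
rewrite -unitfE -unitmxE => uS.
move: S0 => /(congr1 (mulmx (invmx (sylvester m n p q)))).
rewrite mulKmx// mulmx0 => /colP/(_ (Ordinal nm0)); rewrite !mxE expr0 => /eqP.
by rewrite oner_eq0.
Qed.

(** In a relation a p = - b q, the polynomial of full degree divides the opposite cofactor, whose
    degree is smaller; this cofactor is zero, hence so is the other. The last size condition
    excludes a common root at infinity. *)
Lemma sylvester_coprime (F : fieldType) m n (p q : {poly F}) :
  (size p <= m.+1)%N -> (size q <= n.+1)%N ->
  (size p == m.+1) || (size q == n.+1) ->
  coprimep p q -> \det (sylvester m n p q) != 0.
Proof.
move=> sp sq spq cpq; apply/negP => /det0P[u u0].
rewrite -[u]hsubmxK mul_row_sylvester.
set a := rVpoly (lsubmx u); set b := rVpoly (rsubmx u).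
have sa : (size a <= n)%N by exact: size_poly.
have sb : (size b <= m)%N by exact: size_poly.
move/(congr1 rVpoly); rewrite linear0 poly_rV_K; last first.
  rewrite (leq_trans (size_polyD _ _))// geq_max.
  have hM (x y : {poly F}) k l : (size x <= k)%N -> (size y <= l.+1)%N ->
      (size (x * y)%R <= k + l)%N.
    move=> xk yl; apply: leq_trans (size_polyMleq _ _) _.
    by move: xk yl; lia.
  by rewrite hM// addnC hM.
move=> /eqP; rewrite addr_eq0 => /eqP abE.
suff [a0 b0] : a = 0 /\ b = 0.
  move/negP: u0; apply; rewrite -[u]hsubmxK.
  have -> : lsubmx u = 0 by apply: (can_inj rVpolyK); rewrite linear0.
  have -> : rsubmx u = 0 by apply: (can_inj rVpolyK); rewrite linear0.
  by rewrite row_mx0.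
case/orP: spq => /eqP sE.
  have b0 : b = 0.
    apply/eqP; apply: contraTT sb => b0; rewrite -ltnNge.
    suff /dvdp_leq : p %| b by move=> /(_ b0); rewrite sE.
    by rewrite -(Gauss_dvdpl _ cpq) -dvdpNr -abE dvdp_mull.
  split=> //; move/eqP: abE; rewrite b0 mul0r oppr0 mulf_eq0 => /orP[/eqP//|].
  by rewrite -size_poly_eq0 sE.
have a0 : a = 0.
  apply/eqP; apply: contraTT sa => a0; rewrite -ltnNge.
  suff /dvdp_leq : q %| a by move=> /(_ a0); rewrite sE.
  by rewrite coprimep_sym in cpq; rewrite -(Gauss_dvdpl _ cpq) abE dvdpNr dvdp_mull.
split=> //; move/eqP: abE; rewrite a0 mul0r eq_sym oppr_eq0 mulf_eq0 => /orP[/eqP//|].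
by rewrite -size_poly_eq0 sE.
Qed.

Lemma sylvester_det0_root (F : closedFieldType) m n (p q : {poly F}) :
  (size p <= m.+1)%N -> (size q <= n.+1)%N ->
  (size p == m.+1) || (size q == n.+1) ->
  \det (sylvester m n p q) = 0 -> exists z, root p z && root q z.
Proof.
move=> sp sq spq d0.
have : ~~ coprimep p q.
  by apply/negP => /(sylvester_coprime sp sq spq); rewrite d0 eqxx.
rewrite /coprimep => /closed_rootP[z]; rewrite root_gcd => zz.
by exists z.
Qed.

Lemma sylvester_linear (R : comNzRingType) m n a (p q p' q' : {poly R}) :
  sylvester m n (a *: p + p') (a *: q + q') = a *: sylvester m n p q + sylvester m n p' q'.
Proof.
rewrite /sylvester scale_col_mx add_col_mx.
by congr col_mx; apply/matrixP => i j; rewrite !mxE mulrDr -scalerAr coefD coefZ.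
Qed.

(* The determinant of disc_mx N x is, up to a constant factor, the discriminant of
   x seen as a binary form of degree N. *)
Definition disc_mx (R : nzRingType) N (x : {poly R}) :=
  sylvester N.-1 N.-1 x^`() (x *+ N - 'X * x^`()).

(** Linearity turns [disc_mx N (r *: p + q)] into a matrix pencil in r. *)
Lemma disc_mx_linear (R : comNzRingType) N a (x y : {poly R}) :
  disc_mx N (a *: x + y) = a *: disc_mx N x + disc_mx N y.
Proof.
rewrite /disc_mx -sylvester_linear derivD derivZ; congr sylvester.
rewrite mulrnDl mulrDr -scalerAr scalerBr scalerMnr; ring.
Qed.

Section disc_mx_roots.
Variables (C : numClosedFieldType) (N : nat) (x : {poly C}).
Hypotheses (N1 : (1 < N)%N) (sx : (size x <= N.+1)%N).

Let sA : (size x^`() <= N.-1.+1)%N.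
Proof.
apply/leq_sizeP => j jN; rewrite coef_deriv.
by rewrite (leq_sizeP _ _ sx) ?mul0rn//; lia.
Qed.

Let sB : (size (x *+ N - 'X * x^`())%R <= N.-1.+1)%N.
Proof.
apply/leq_sizeP => -[|j] jN; first by lia.
rewrite coefB coefMn coefXM/= coef_deriv.
case: (leqP N j) => jN'.
  by rewrite (leq_sizeP _ _ sx) ?mul0rn ?subr0.
(* The coefficients of X^N in N x and in X x' cancel. *)
have NE : N = j.+1 by lia.
by rewrite -NE subrr.
Qed.

Lemma disc_mx_double_root z : root x z -> root x^`() z -> \det (disc_mx N x) = 0.
Proof.
move=> xz dxz; apply: (@sylvester_root _ _ _ _ _ z) => //; first by lia.
by rewrite rootE hornerD hornerN hornerM hornerMn (rootP xz) (rootP dxz) mulr0 mul0rn subr0.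
Qed.

(** Up to homogenization, x' and N x - X x' are the partial derivatives of the binary form of x, so
    a common zero is a double root. A nonzero coefficient among the top two excludes a double root
    at infinity. *)
Lemma disc_mx_det0 : (x`_N != 0) || (x`_N.-1 != 0) -> \det (disc_mx N x) = 0 ->
  exists z, root x z && root x^`() z.
Proof.
have sz (y : {poly C}) : (size y <= N.-1.+1)%N -> y`_N.-1 != 0 -> size y == N.-1.+1.
  move=> sy yN; rewrite eqn_leq sy/=; apply: contraNltn yN => yN.
  by rewrite nth_default.
have NE : N = N.-1.+1 by lia.
move=> xN /(sylvester_det0_root sA sB)[|z /andP[z1 z2]].
  case/orP: xN => xN; apply/orP; [left|right]; apply: sz => //.
    by rewrite coef_deriv -NE mulrn_eq0 negb_or xN andbT -lt0n; lia.
  (* The coefficient of X^(N-1) is N x_(N-1) - (N-1) x_(N-1) = x_(N-1). *)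
  rewrite coefB coefMn coefXM coef_deriv.
  case: N N1 NE xN => [//|[//|k]] _ _ /= xN.
  by rewrite mulrS addrK.
exists z; rewrite z1 andbT.
move: z2; rewrite !rootE hornerD hornerN hornerM hornerMn (rootP z1) mulr0 subr0.
by rewrite mulrn_eq0 => /orP[|//]; lia.
Qed.

End disc_mx_roots.

(** The bordered matrix B is reduced by eliminating either diagonal block. With [\adj A] in place of
    the inverse no fractions occur, and the surplus power of [\det A] is cancelled at the end. *)
Lemma det_rank1 (R : idomainType) n (A : 'M[R]_n) (x : 'cV_n) (y : 'rV_n) :
  \det A != 0 -> \det (A + x *m y) = \det A + (y *m \adj A *m x) 0 0.
Proof.
move=> A0; pose B := block_mx A (- x) y 1%:M.
have dB : \det B = \det (A + x *m y).
  have -> : B = block_mx 1%:M (- x) 0 1%:M *m block_mx (A + x *m y) 0 y 1%:M.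
    by rewrite mulmx_block !mul1mx !mul0mx !mulmx1 mulNmx addrK !add0r.
  by rewrite det_mulmx det_ublock det_lblock !det1 !mul1r mulr1.
have E : B *m block_mx (\adj A) (\adj A *m x) 0 (\det A)%:M =
    block_mx (\det A)%:M 0 (y *m \adj A) (y *m \adj A *m x + (\det A)%:M).
  rewrite mulmx_block mul_mx_adj !mulmx0 !addr0 mulmxA mul_mx_adj mul1mx mulmxA.
  by rewrite mulNmx mul_scalar_mx mul_mx_scalar subrr.
move/(congr1 (fun M => \det M)): E.
rewrite det_mulmx det_ublock det_lblock !det_scalar dB det_mx11 expr1.
have := congr1 (fun M => \det M) (mul_mx_adj A); rewrite det_mulmx det_scalar => E.
rewrite [\det (\adj A) * _]mulrC E mulrC !mxE eqxx mulr1n.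
move => /mulfI -> //; first by rewrite addrC.
by rewrite expf_neq0.
Qed.

(** * Rank-one perturbations of unitary matrices *)

(** This is the characteristic polynomial times the resolvent form x (X - A)^-1 y. *)
Definition adjform (R : comNzRingType) n (A : 'M[R]_n) (x : 'rV_n) (y : 'cV_n) :
    {poly R} :=
  (map_mx polyC x *m \adj (char_poly_mx A) *m map_mx polyC y) 0 0.

Lemma adjformDr (R : comNzRingType) n (A : 'M[R]_n) x y y' :
  adjform A x (y + y') = adjform A x y + adjform A x y'.
Proof. by rewrite /adjform map_mxD !mulmxDr mxE. Qed.

Lemma adjformZl (R : comNzRingType) n (A : 'M[R]_n) a x y :
  adjform A (a *: x) y = a *: adjform A x y.
Proof. by rewrite /adjform map_mxZ -!scalemxAl mxE mul_polyC. Qed.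

Lemma adjformZr (R : comNzRingType) n (A : 'M[R]_n) a x y :
  adjform A x (a *: y) = a *: adjform A x y.
Proof. by rewrite /adjform map_mxZ -!scalemxAr mxE mul_polyC. Qed.

(** On an eigenvector X - u acts as X - A, which the adjugate turns into the characteristic
    polynomial. *)
Lemma adjform_eigen (R : comNzRingType) n (A : 'M[R]_n) x e u : A *m e = u *: e ->
  ('X - u%:P) * adjform A x e = (x *m e) 0 0 *: char_poly A.
Proof.
move=> Ae.
have E : ('X - u%:P) *: map_mx polyC e = char_poly_mx A *m map_mx polyC e.
  rewrite /char_poly_mx mulmxBl mul_scalar_mx -map_mxM Ae map_mxZ.
  by rewrite scalerBl.
have -> : ('X - u%:P) * adjform A x e =
    (map_mx polyC x *m \adj (char_poly_mx A) *m (('X - u%:P) *: map_mx polyC e)) 0 0.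
  by rewrite -scalemxAr mxE.
rewrite E -mulmxA [\adj _ *m _]mulmxA mul_adj_mx mul_scalar_mx -scalemxAr -map_mxM.
by rewrite !mxE mulrC mul_polyC.
Qed.

Lemma char_poly_rank1 (F : fieldType) n (A : 'M[F]_n) (x : 'rV_n) (y : 'cV_n) :
  char_poly (A - y *m x) = char_poly A + adjform A x y.
Proof.
rewrite /char_poly (_ : char_poly_mx _ =
  char_poly_mx A + map_mx polyC y *m map_mx polyC x); last first.
  by rewrite /char_poly_mx map_mxB map_mxM opprB addrCA addrC.
by rewrite det_rank1// -/(char_poly A) monic_neq0 ?char_poly_monic.
Qed.

(** The form is the difference of two monic polynomials of degree n. *)
Lemma size_adjform (F : fieldType) n (A : 'M[F]_n) x y : (size (adjform A x y) <= n)%N.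
Proof.
have -> : adjform A x y = char_poly (A - y *m x) - char_poly A.
  by rewrite char_poly_rank1 addrC addKr.
have lc (B : 'M[F]_n) : (char_poly B)`_n = 1.
  by rewrite -(monicP (char_poly_monic B)) /lead_coef size_char_poly.
apply/leq_sizeP => j; rewrite leq_eqVlt => /orP[/eqP <-|nj].
  by rewrite coefB !lc subrr.
by rewrite coefB !nth_default ?subrr// size_char_poly.
Qed.

Lemma mulmx_trC_gt0 (C : numClosedFieldType) n (e : 'cV[C]_n) :
  e != 0 -> 0 < (e^t* *m e) 0 0.
Proof.
move=> e0; rewrite mxE.
have ge0 j : 0 <= e^t* 0 j * e j 0 by rewrite !mxE mulrC mul_conjC_ge0.
rewrite lt_def sumr_ge0 ?andbT//.
apply: contra_neq e0 => /psumr_eq0P H; apply/colP => j.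
have /eqP := H (fun i _ => ge0 i) j isT; rewrite !mxE mulrC mul_conjC_eq0.
by move/eqP.
Qed.

Lemma trmxCZ (C : numClosedFieldType) m n a (A : 'M[C]_(m, n)) :
  (a *: A)^t* = a^* *: A^t*.
Proof. by apply/matrixP => i j; rewrite !mxE rmorphM. Qed.

Lemma trmxCD (C : numClosedFieldType) m n (A B : 'M[C]_(m, n)) :
  (A + B)^t* = A^t* + B^t*.
Proof. by apply/matrixP => i j; rewrite !mxE rmorphD. Qed.

Section unitary.
Variables (C : numClosedFieldType) (n : nat) (U : 'M[C]_n).
Hypothesis uU : U \is unitarymx.

(** A root of the characteristic polynomial first yields a left eigenvector x. Evaluating x U U^*
    x^* in two ways gives |u| = 1, and then U U^* = 1 makes x^* a right eigenvector, which is
    normalized. *)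
Lemma unitarymx_eigenvector u : root (char_poly U) u ->
  `|u| = 1 /\ exists2 e : 'cV[C]_n, U *m e = u *: e & (e^t* *m e) 0 0 = 1.
Proof.
have UU := unitarymxP uU.
rewrite -eigenvalue_root_char => /eigenvalueP[x xU x0].
pose e := x^t*.
have eE : e^t* = x by rewrite trmxCK.
have e0 : e != 0 by apply: contra_neq x0 => e0; rewrite -eE e0 trmx0 map_mx0.
have ee0 := mulmx_trC_gt0 e0.
have UE : U^t* *m e = u^* *: e.
  by rewrite /e -map_mxM -trmx_mul xU trmxCZ.
have u1 : `|u| = 1.
  have : (x *m U *m (U^t* *m e)) 0 0 = (x *m e) 0 0.
    by rewrite mulmxA -[x *m U *m _]mulmxA UU mulmx1.
  rewrite xU UE -scalemxAl -scalemxAr scalerA mxE -[X in X *m e]eE.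
  rewrite -[RHS]mul1r => /mulIf; rewrite gt_eqF// => /(_ isT).
  by rewrite -normCK => /eqP; rewrite sqrp_eq1// => /eqP.
split=> //.
have Ue : U *m e = u *: e.
  have : U *m (U^t* *m e) = e by rewrite mulmxA UU mul1mx.
  rewrite UE -scalemxAr => /(congr1 ( *:%R u)).
  by rewrite scalerA -normCK u1 expr1n scale1r.
pose a := (sqrtC ((e^t* *m e) 0 0))^-1.
exists (a *: e); first by rewrite -scalemxAr Ue !scalerA mulrC.
rewrite trmxCZ -scalemxAl -scalemxAr scalerA mxE.
have a0 : 0 <= a by rewrite invr_ge0 sqrtC_ge0 ltW.
by rewrite (geC0_conj a0) -invfM -expr2 sqrtCK mulVf// gt_eqF.
Qed.

(** Unitarity gives <e1, e2> = u1^* u2 <e1, e2>, and u1^* u2 differs from 1. *)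
Lemma unitarymx_eigenvector_ortho u1 u2 (e1 e2 : 'cV[C]_n) :
  `|u1| = 1 -> u1 != u2 -> U *m e1 = u1 *: e1 -> U *m e2 = u2 *: e2 ->
  (e1^t* *m e2) 0 0 = 0.
Proof.
move=> n1 u12 E1 E2.
have : (e1^t* *m e2) = (U *m e1)^t* *m (U *m e2).
  rewrite trmx_mul map_mxM mulmxA -[_ *m U^t* *m U]mulmxA.
  by have := uU; rewrite -trmxC_unitary => /unitarymxP; rewrite trmxCK => ->;
    rewrite mulmx1.
rewrite E1 E2 trmxCZ -scalemxAl -scalemxAr scalerA.
move=> /(congr1 (fun M : 'M[C]_1 => M 0 0)); rewrite [RHS]mxE => /eqP.
rewrite -subr_eq0 -{1}[(e1^t* *m e2) 0 0]mul1r -mulrBl mulf_eq0 => /orP[|/eqP//].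
rewrite subr_eq0 => /eqP E; case/eqP: u12.
by rewrite -[LHS]mulr1 E mulrA -normCK n1 expr1n mul1r.
Qed.

End unitary.

(** * Two-dimensional perturbation directions *)

(** The numbers 1/2, 1/3, ... supply [size p] distinct points of the interval, more than p has
    roots. *)
Lemma exists_nonroot_01 (C : numFieldType) (p : {poly C}) : p != 0 ->
  exists2 w : C, 0 < w < 1 & ~~ root p w.
Proof.
move=> p0; pose rs : seq C := [seq (m.+2%:R)^-1 | m <- iota 0 (size p)].
have urs : uniq rs.
  rewrite map_inj_uniq ?iota_uniq// => a b /invr_inj/eqP.
  by rewrite eqr_nat => /eqP[].
have [/(max_poly_roots p0)/(_ urs)|] := boolP (all (root p) rs).
  by rewrite size_map size_iota ltnn.
move=> /allPn[w /mapP[m _ ->] wp]; exists (m.+2%:R)^-1 => //.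
by rewrite invr_gt0 ltr0n invf_lt1 ?ltr0n// ltr1n.
Qed.

Lemma root_mul_deriv (F : fieldType) (P Y : {poly F}) z :
  root (P * Y) z -> root (P * Y)^`() z ->
  root P z && root (P^`() * Y) z || root Y z && root Y^`() z.
Proof.
rewrite derivM !rootE hornerD !hornerM.
have [->|Pz] := eqVneq P.[z] 0; first by rewrite !mul0r addr0 => _ ->.
rewrite mulf_eq0 (negbTE Pz)/= => /eqP ->.
by rewrite mulr0 add0r mulf_eq0 (negbTE Pz)/= eqxx => ->.
Qed.

Section two_points.
Variables (C : numClosedFieldType) (u1 u2 w1 w2 : C).
Hypotheses (nu1 : `|u1| = 1) (nu2 : `|u2| = 1) (u12 : u1 != u2).
Hypotheses (w1_gt0 : 0 < w1) (w2_gt0 : 0 < w2) (w12 : w1 + w2 = 1).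

(** The quadratic left from r p + q, for v = sqrt(w1) e1 + sqrt(w2) e2, once the factors of the
    other eigenvalues are divided out. *)
Definition two_point_poly r : {poly C} :=
  r *: (('X - u1%:P) * ('X - u2%:P)) +
  ((w1 * u1) *: ('X - u2%:P) + (w2 * u2) *: ('X - u1%:P)).

(** Vanishing of the discriminant of this quadratic, whose constant term is (r - 1) u1 u2 because w1
    + w2 = 1. *)
Definition two_point_disc r : Prop :=
  (r * (u1 + u2) - (w1 * u1 + w2 * u2)) ^+ 2 = 4 * r * (r - 1) * (u1 * u2).

Let conjU (u : C) : `|u| = 1 -> u^* = u^-1.
Proof. by move=> u1E; rewrite invC_norm u1E expr1n invr1 mul1r. Qed.

Let unit_neq0 (u : C) : `|u| = 1 -> u != 0.
Proof. by move=> u1E; rewrite -normr_eq0 u1E oner_eq0. Qed.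

Let w2E : w2 = 1 - w1.
Proof. by rewrite -w12 addrC addKr. Qed.

Let horner2 r z : (two_point_poly r).[z] =
  r * ((z - u1) * (z - u2)) + (w1 * u1 * (z - u2) + w2 * u2 * (z - u1)).
Proof. by rewrite /two_point_poly !hornerE. Qed.

Lemma two_point_double_root r z :
  root (two_point_poly r) z -> root (two_point_poly r)^`() z -> two_point_disc r.
Proof.
move=> /rootP; rewrite horner2 => E1 /rootP E2.
apply/eqP; rewrite -subr_eq0; apply/eqP.
(* The identity b^2 - 4 a c = (2 a z + b)^2 - 4 a (a z^2 + b z + c). *)
transitivity ((r * (z - u2 + (z - u1)) + (w1 * u1 + w2 * u2)) ^+ 2 -
  4 * r * (r * ((z - u1) * (z - u2)) + (w1 * u1 * (z - u2) + w2 * u2 * (z - u1)))).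
  by rewrite w2E; ring.
rewrite E1 mulr0 subr0 (_ : _ + _ = 0) ?expr0n//= -[RHS]E2.
by rewrite /two_point_poly !poly.derivE !hornerE; ring.
Qed.

(* Here |r (u1 + u2) - w1 u1 - w2 u2| <= |r - w1| + |r - w2| < 2 |r|. *)
Lemma two_point_disc_neq r : r + r^* = 1 -> ~ two_point_disc r.
Proof.
move=> rE.
have rJ : r^* = 1 - r by rewrite -rE addrC addKr.
(* Since r^* = 1 - r, one has |r|^2 - |r - w|^2 = w (1 - w). *)
have nw w : w^* = w -> 0 < w * (1 - w) -> `|r - w| < `|r|.
  move=> wJ ww; rewrite -ltr_sqr ?nnegrE// !normCK rmorphB/= wJ rJ -subr_gt0.
  by rewrite (_ : _ - _ = w * (1 - w))//; ring.
have w1J : w1^* = w1 by rewrite geC0_conj ?ltW.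
have w2J : w2^* = w2 by rewrite geC0_conj ?ltW.
have n1 : `|r - w1| < `|r| by rewrite nw// -w12 addrC addKr mulr_gt0.
have n2 : `|r - w2| < `|r| by rewrite nw// -w12 addrK mulr_gt0.
move=> /(congr1 Num.norm); rewrite normrX !normrM nu1 nu2 !mulr1.
have -> : `|r - 1| = `|r| by rewrite -[RHS]norm_conjC rJ distrC.
rewrite -mulrA -expr2 (ger0_norm (ler0n _ 4)) => /eqP; apply/negP.
rewrite lt_eqF// (_ : 4 * _ = (2 * `|r|) ^+ 2); last by ring.
rewrite ltr_sqr ?nnegrE ?mulr_ge0//.
have -> : r * (u1 + u2) - (w1 * u1 + w2 * u2) = (r - w1) * u1 + (r - w2) * u2 by ring.
rewrite (le_lt_trans (ler_normD _ _))// !normrM nu1 nu2 !mulr1.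
by rewrite (_ : 2 * `|r| = `|r| + `|r|) ?ltrD//; ring.
Qed.

(** Conjugating the equation at r^* and multiplying by (u1 u2)^2 gives the equation at r with the
    weights exchanged. The right-hand sides agree, and the difference of the squares factors as (w1
    - w2) (u1 - u2) (u1 + u2) (2 r - 1), whence r = 1/2. *)
Lemma two_point_disc_conj r : u1 + u2 != 0 -> w1 != w2 ->
  two_point_disc r -> two_point_disc r^* -> r + r^* = 1.
Proof.
move=> S0 w1w2 dr drJ.
have z1 := unit_neq0 nu1; have z2 := unit_neq0 nu2.
have w1J : w1^* = w1 by rewrite geC0_conj ?ltW.
have w2J : w2^* = w2 by rewrite geC0_conj ?ltW.
have dr' : (r * (u1 + u2) - (w1 * u2 + w2 * u1)) ^+ 2 = 4 * r * (r - 1) * (u1 * u2).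
  move: drJ => /(congr1 (fun x => x^* * (u1 * u2) ^+ 2)).
  rewrite !(rmorphXn, rmorphM, rmorphB, rmorphD, rmorph1, rmorph_nat) /= conjCK.
  rewrite (conjU nu1) (conjU nu2) w1J w2J => E.
  rewrite (_ : r * (u1 + u2) - (w1 * u2 + w2 * u1) =
    (r * (u1^-1 + u2^-1) - (w1 * u1^-1 + w2 * u2^-1)) * (u1 * u2)); last first.
    by field; rewrite z1 z2.
  by rewrite exprMn E; field; rewrite z1 z2.
have : (w1 - w2) * (u1 - u2) * ((u1 + u2) * (2 * r - 1)) = 0.
  have -> : (w1 - w2) * (u1 - u2) * ((u1 + u2) * (2 * r - 1)) =
    (r * (u1 + u2) - (w1 * u2 + w2 * u1)) ^+ 2 -
    (r * (u1 + u2) - (w1 * u1 + w2 * u2)) ^+ 2.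
    by rewrite w2E; ring.
  by rewrite dr dr' subrr.
move/eqP; rewrite !mulf_eq0 !subr_eq0 (negbTE w1w2) (negbTE u12) (negbTE S0)/=.
move=> /eqP rE; have -> : r = 2^-1.
  by rewrite -[LHS](mulKf (_ : 2 != 0)) ?pnatr_eq0// rE mulr1.
by rewrite geC0_conj ?invr_ge0 ?ler0n//; field.
Qed.

(** Dividing by (u - u1) (u - u2) gives r = - w1 u1 / (u - u1) - w2 u2 / (u - u2), and on the unit
    circle both u1 / (u - u1) and u2 / (u - u2) have real part -1/2. *)
Lemma two_point_poly_unit_root r u : `|u| = 1 -> u != u1 -> u != u2 ->
  root (two_point_poly r) u -> r + r^* = 1.
Proof.
move=> nu uu1 uu2; rewrite rootE horner2 => /eqP E.
have z1 := unit_neq0 nu1; have z2 := unit_neq0 nu2; have z := unit_neq0 nu.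
have w1J : w1^* = w1 by rewrite geC0_conj ?ltW.
have w2J : w2^* = w2 by rewrite geC0_conj ?ltW.
have := congr1 (fun x => x^* * (u ^+ 2 * (u1 * u2))) E.
rewrite !(rmorphXn, rmorphM, rmorphB, rmorphD, rmorph0) /=.
rewrite (conjU nu1) (conjU nu2) (conjU nu) w1J w2J mul0r.
move=> E'; apply: (mulIf (_ : (u - u1) * (u - u2) != 0)).
  by rewrite mulf_neq0// subr_eq0.
apply/eqP; rewrite -subr_eq0 -[X in _ == X]addr0 -{1}E -E'; apply/eqP.
by rewrite w2E; field; rewrite z1 z2 z.
Qed.

(** Because r + r^* = 1, the two equations, suitably multiplied, add up to one without r. It is
    linear in the weights, so that a choice of w1 can avoid it. *)
Lemma two_point_poly_unit_roots r u u' : `|u| = 1 ->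
  u != u1 -> u != u2 -> u' != u1 -> u' != u2 ->
  root (two_point_poly r) u -> root (two_point_poly r^*) u' ->
  w1 * ((u * u' - u1 ^+ 2) * ((u - u2) * (u' - u2))) +
  w2 * ((u * u' - u2 ^+ 2) * ((u - u1) * (u' - u1))) = 0.
Proof.
move=> nu a1 a2 b1 b2 H; have rE := two_point_poly_unit_root nu a1 a2 H.
have -> : r^* = 1 - r by rewrite -rE addrC addKr.
move: H; rewrite !rootE !horner2 => /eqP E1 /eqP E2.
transitivity ((r * ((u - u1) * (u - u2)) + (w1 * u1 * (u - u2) + w2 * u2 * (u - u1)))
    * ((u' - u1) * (u' - u2)) +
   ((1 - r) * ((u' - u1) * (u' - u2)) + (w1 * u1 * (u' - u2) + w2 * u2 * (u' - u1)))
    * ((u - u1) * (u - u2))); last by rewrite E1 E2 !mul0r addr0.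
by rewrite w2E; ring.
Qed.

End two_points.

(** * A direction without collisions for a unitary matrix with simple spectrum *)

Definition rank1_pert (C : numClosedFieldType) n (U : 'M[C]_n) (v : 'cV_n) : {poly C} :=
  adjform U (v^t*) (U *m v).

Section unitary_simple.
Variables (C : numClosedFieldType) (N : nat) (U : 'M[C]_N) (l : 'I_N -> C).
Hypotheses (uU : U \is unitarymx) (cU : char_poly U = \prod_i ('X - (l i)%:P)).
Hypotheses (linj : injective l).

Let lroot i : root (char_poly U) (l i).
Proof. by rewrite cU (bigD1 i)//= rootM root_XsubC eqxx. Qed.

Let prod_root (P : pred 'I_N) z :
  root (\prod_(k | P k) ('X - (l k)%:P)) z -> exists2 k, P k & z = l k.
Proof.
rewrite rootE horner_prod => /prodf_eq0[k Pk].
by rewrite hornerXsubC subr_eq0 => /eqP ->; exists k.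
Qed.

Let prod_deriv_root (P : pred 'I_N) k : P k ->
  ~~ root (\prod_(k | P k) ('X - (l k)%:P))^`() (l k).
Proof.
move=> Pk; rewrite (bigD1 k)//= derivM derivXsubC mul1r rootE hornerD hornerM.
rewrite hornerXsubC subrr mul0r addr0 -rootE.
by apply/negP => /prod_root[j /andP[_ jk] /linj jE]; rewrite jE eqxx in jk.
Qed.

Lemma unitarymx_spectrum_norm i : `|l i| = 1.
Proof. by have [] := unitarymx_eigenvector uU (lroot i). Qed.

(** For v a unit eigenvector of l_i, q is l_i times the product of the X - l_j with j <> i. *)
Lemma rank1_pert_neq0_at_eigenvalue i : exists v, (rank1_pert U v).[l i] != 0.
Proof.
have [_ [e Ue ee]] := unitarymx_eigenvector uU (lroot i); exists e.
have E : ('X - (l i)%:P) * rank1_pert U e = l i *: char_poly U.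
  by rewrite /rank1_pert Ue adjformZr -scalerAr (adjform_eigen _ Ue) ee scale1r.
have {E}-> : rank1_pert U e = l i *: \prod_(j | j != i) ('X - (l j)%:P).
  apply: (mulfI (_ : 'X - (l i)%:P != 0)); first by rewrite polyXsubC_eq0.
  by rewrite E cU (bigD1 i)//= scalerAr.
rewrite hornerZ mulf_neq0//; first by rewrite -normr_eq0 unitarymx_spectrum_norm oner_eq0.
by apply/negP => /prod_root[j ji /linj jE]; rewrite jE eqxx in ji.
Qed.

Lemma disc_mx_char_poly_neq0 : (1 < N)%N -> \det (disc_mx N (char_poly U)) != 0.
Proof.
move=> N1; apply/eqP => /disc_mx_det0[]//; first by rewrite size_char_poly.
  have := monicP (char_poly_monic U); rewrite /lead_coef size_char_poly => -> .
  by rewrite oner_eq0.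
move=> z /andP[]; rewrite cU => /prod_root[k _ ->].
by apply/negP; exact: prod_deriv_root.
Qed.

(** If l_0 + l_1 and l_0 + l_2 both vanished, l_1 and l_2 would coincide. *)
Lemma exists_non_antipodal : (2 < N)%N -> exists i j, i != j /\ l i + l j != 0.
Proof.
move=> N2; pose o k (kN : (k < 3)%N) := Ordinal (leq_trans kN N2).
have [E|] := eqVneq (l (o 0 isT) + l (o 1 isT)) 0; last by exists (o 0 isT), (o 1 isT).
exists (o 0 isT), (o 2 isT); split=> //.
by rewrite -E; apply/eqP => /addrI/linj/(congr1 val).
Qed.

Lemma exists_rank1_pert_simple : (2 < N)%N -> exists2 v : 'cV[C]_N, (v^t* *m v) 0 0 = 1 &
  forall r, ~ (\det (disc_mx N (r *: char_poly U + rank1_pert U v)) = 0 /\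
               \det (disc_mx N (r^* *: char_poly U + rank1_pert U v)) = 0).
Proof.
move=> N2; have [i [j [ij Sij]]] := exists_non_antipodal N2.
have lij : l i != l j by apply: contra_neq ij => /linj.
have [n1 [e1 Ue1 ee1]] := unitarymx_eigenvector uU (lroot i).
have [n2 [e2 Ue2 ee2]] := unitarymx_eigenvector uU (lroot j).
have e12 := unitarymx_eigenvector_ortho uU n1 lij Ue1 Ue2.
have e21 : (e2^t* *m e1) 0 0 = 0.
  by apply: (unitarymx_eigenvector_ortho uU n2 _ Ue2 Ue1); rewrite eq_sym.
pose ok k := (k != i) && (k != j).
(* A and B are the coefficients of w1 and w2 in [two_point_poly_unit_roots], at u = l_k and u' =
   l_m. *)
pose A k m := (l k * l m - l i ^+ 2) * ((l k - l j) * (l m - l j)).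
pose B k m := (l k * l m - l j ^+ 2) * ((l k - l i) * (l m - l i)).
(* A non-root w of G, taken as w1, is not 1/2 and violates every relation w1 A + w2 B = 0. *)
pose G : {poly C} := ('X *+ 2 - 1) *
  \prod_(km | ok km.1 && ok km.2) ((A km.1 km.2)%:P * 'X + (B km.1 km.2)%:P * (1 - 'X)).
have linB k m : k != m -> l k - l m != 0.
  by move=> km; rewrite subr_eq0; apply: contra_neq km => /linj.
have lne k m : k != m -> l k != l m by move=> km; apply: contra_neq km => /linj.
have G0 : G != 0.
  rewrite mulf_neq0//.
    apply/eqP => /(congr1 (horner^~ 0)); rewrite !hornerE => /eqP.
    by rewrite ?mul0rn ?sub0r ?add0r ?mulr0n oppr_eq0 oner_eq0.
  (* Evaluation at 1 and at 0 isolates A and B. Both vanish only if l_i^2 = l_k l_m = l_j^2, against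
     l_i <> l_j and l_i <> - l_j. *)
  apply/prodf_neq0 => -[k m] /= /andP[/andP[ki kj] /andP[mi mj]]; apply/eqP => H.
  have A0 : A k m = 0.
    have := congr1 (horner^~ 1) H; rewrite hornerD !hornerM !hornerC hornerX ?horner0.
    by rewrite hornerD hornerN hornerX hornerC subrr mulr0 mulr1 addr0.
  have B0 : B k m = 0.
    have := congr1 (horner^~ 0) H; rewrite hornerD !hornerM !hornerC hornerX ?horner0.
    by rewrite hornerD hornerN hornerX hornerC subr0 mulr0 mulr1 add0r.
  have /eqP : (l k * l m - l i ^+ 2) = 0.
    apply: (mulIf (_ : (l k - l j) * (l m - l j) != 0)); last by rewrite mul0r.
    by rewrite mulf_neq0// linB.
  have /eqP : (l k * l m - l j ^+ 2) = 0.
    apply: (mulIf (_ : (l k - l i) * (l m - l i) != 0)); last by rewrite mul0r.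
    by rewrite mulf_neq0// linB.
  rewrite !subr_eq0 => /eqP -> ; rewrite eqf_sqr eq_sym (negbTE lij)/=.
  by rewrite -addr_eq0 addrC (negbTE Sij).
have [w /andP[w0 w1]] := exists_nonroot_01 G0.
rewrite rootM negb_or => /andP[wh wG].
have w0' : 0 < 1 - w by rewrite subr_gt0.
have w12 : w + (1 - w) = 1 by rewrite addrC subrK.
have ww : w != 1 - w.
  apply: contraNneq wh => wE; rewrite rootE !hornerE.
  by rewrite {1}wE subrK subrr.
pose v := sqrtC w *: e1 + sqrtC (1 - w) *: e2.
have sq x : 0 < x -> (sqrtC x)^* * sqrtC x = x.
  by move=> x0; rewrite geC0_conj ?sqrtC_ge0 ?ltW// -expr2 sqrtCK.
pose P := \prod_(k | ok k) ('X - (l k)%:P).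
have PE : char_poly U = ('X - (l i)%:P) * (('X - (l j)%:P) * P).
  by rewrite cU (bigD1 i)//= (bigD1 j) 1?eq_sym.
have vT : v^t* = (sqrtC w)^* *: e1^t* + (sqrtC (1 - w))^* *: e2^t*.
  by rewrite trmxCD !trmxCZ.
(* [adjform_eigen] gives the form multiplied by X - l_i, a factor which is then cancelled. *)
have q1 : adjform U (v^t*) e1 = (sqrtC w)^* *: (('X - (l j)%:P) * P).
  apply: (mulfI (_ : 'X - (l i)%:P != 0)); first by rewrite polyXsubC_eq0.
  rewrite (adjform_eigen _ Ue1) PE -scalerAr vT mulmxDl -!scalemxAl.
  by rewrite mxE [X in X + _]mxE [X in _ + X]mxE ee1 e21 mulr0 mulr1 addr0.
have q2 : adjform U (v^t*) e2 = (sqrtC (1 - w))^* *: (('X - (l i)%:P) * P).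
  apply: (mulfI (_ : 'X - (l j)%:P != 0)); first by rewrite polyXsubC_eq0.
  rewrite (adjform_eigen _ Ue2) PE -scalerAr mulrCA vT mulmxDl -!scalemxAl.
  by rewrite mxE [X in X + _]mxE [X in _ + X]mxE ee2 e12 mulr0 mulr1 add0r.
have qE : rank1_pert U v = P *
    ((w * l i) *: ('X - (l j)%:P) + ((1 - w) * l j) *: ('X - (l i)%:P)).
  rewrite /rank1_pert {2}/v mulmxDr -!scalemxAr Ue1 Ue2 adjformDr !adjformZr q1 q2 !scalerA.
  rewrite mulrDr -!scalerAr ![P * _]mulrC; congr (_ *: _ + _ *: _).
    by rewrite mulrAC [_ * (sqrtC w)^*]mulrC sq.
  by rewrite mulrAC [_ * (sqrtC (1 - w))^*]mulrC sq.
have XE r : r *: char_poly U + rank1_pert U v =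
    P * two_point_poly (l i) (l j) w (1 - w) r.
  rewrite qE PE /two_point_poly [RHS]mulrDr; congr (_ + _); rewrite -[RHS]scalerAr.
  by congr (_ *: _); ring.
(* This is the coefficient of X^(N-1) in q, needed at r = 0, where r p + q has no term of degree N.
   The two summands have different moduli w and 1 - w. *)
have mlead : w * l i + (1 - w) * l j != 0.
  apply/eqP => /eqP; rewrite addr_eq0 => /eqP/(congr1 Num.norm)/eqP.
  by rewrite normrN !normrM n1 n2 !mulr1 !gtr0_norm// (negbTE ww).
exists v.
  rewrite vT /v mulmxDr !mulmxDl -!scalemxAl -!scalemxAr.
  have -> : e1^t* *m e1 = 1%:M by rewrite [LHS]mx11_scalar ee1.
  have -> : e2^t* *m e2 = 1%:M by rewrite [LHS]mx11_scalar ee2.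
  have -> : e1^t* *m e2 = 0 by rewrite [LHS]mx11_scalar e12 raddf0.
  have -> : e2^t* *m e1 = 0 by rewrite [LHS]mx11_scalar e21 raddf0.
  rewrite !scaler0 addr0 add0r !scalerA -scalerDl !mxE mulr1n mulr1.
  by rewrite mulrC sq// mulrC sq.
have mP : P \is monic by rewrite monic_prod_XsubC.
have sP : size P = N.-1.
  have P0 := monic_neq0 mP.
  have := size_char_poly U; rewrite PE !size_monicM ?monicXsubC//.
    by rewrite !size_XsubC !addSn !add0n/= => [[]] <-.
  by rewrite mulf_neq0// polyXsubC_eq0.
(* A double root of r p + q is either a double root of the quadratic or a root shared by the
   quadratic and P, because the roots of P are simple. *)
have dP r : \det (disc_mx N (r *: char_poly U + rank1_pert U v)) = 0 ->
    two_point_disc (l i) (l j) w (1 - w) r \/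
    exists2 k, ok k & root (two_point_poly (l i) (l j) w (1 - w) r) (l k).
  move=> /disc_mx_det0[].
  - by rewrite ltnW.
  - rewrite (leq_trans (size_polyD _ _))// geq_max (leq_trans (size_scale_leq _ _)).
      by rewrite (leq_trans (size_adjform _ _ _)).
    by rewrite size_char_poly.
  - rewrite !coefD !coefZ.
    have [->|r0] := eqVneq r 0; last first.
      rewrite [(rank1_pert U v)`_N]nth_default ?size_adjform// addr0.
      have := monicP (char_poly_monic U); rewrite /lead_coef size_char_poly => ->.
      by rewrite mulr1 r0.
    apply/orP; right; rewrite mul0r add0r qE.
    have -> : (w * l i) *: ('X - (l j)%:P) + ((1 - w) * l j) *: ('X - (l i)%:P) =
       (w * l i + (1 - w) * l j) *: 'X - (l i * l j)%:P.
      rewrite !scalerBr -!mul_polyC !polyCM !polyCD !polyCM polyCN polyC1; ring.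
    rewrite mulrBr -scalerAr coefB coefZ coefMX coefMC.
    rewrite [P`_N.-1]nth_default ?sP// mul0r subr0 -subn1.
    rewrite subn_eq0 leqNgt (ltnW N2)/= subn1.
    by have := monicP mP; rewrite /lead_coef sP => ->; rewrite mulr1.
  move=> z /andP[]; rewrite XE => h1 h2.
  have /orP[/andP[Pz]|/andP[Yz dYz]] := root_mul_deriv h1 h2; last first.
    by left; exact: two_point_double_root Yz dYz.
  have [k kk zE] := prod_root Pz.
  by rewrite zE rootM (negbTE (prod_deriv_root kk))/= => Yk; right; exists k.
move=> r [].
have rJ : r^* + r = r + r^* by exact: addrC.
have nd s : s + s^* = 1 -> ~ two_point_disc (l i) (l j) w (1 - w) s.
  exact: two_point_disc_neq.
have rt s k : ok k -> root (two_point_poly (l i) (l j) w (1 - w) s) (l k) -> s + s^* = 1.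
  move=> /andP[ki kj]; apply: two_point_poly_unit_root => //.
  - exact: unitarymx_spectrum_norm.
  - exact: lne.
  - exact: lne.
(* A shared root forces r + r^* = 1, where the discriminant cannot vanish; two vanishing
   discriminants force the same equality; two shared roots contradict the choice of w. *)
move=> /dP[d1|[k kk k1]] /dP[d2|[m mm m2]].
- by apply: (nd r) => //; apply: two_point_disc_conj d1 d2.
- by apply: (nd r) => //; rewrite -rJ -[X in _ + X]conjCK; exact: rt m2.
- apply: (nd r^*) => //; rewrite conjCK rJ; exact: rt k1.
have /andP[ki kj] := kk; have /andP[mi mj] := mm.
have := two_point_poly_unit_roots n1 n2 w0 w0' w12 (unitarymx_spectrum_norm k)
  (lne _ _ ki) (lne _ _ kj) (lne _ _ mi) (lne _ _ mj) k1 m2.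
move=> E.
case/negP: wG; rewrite rootE horner_prod; apply/prodf_eq0.
exists (k, m); first by rewrite /= kk mm.
by rewrite !hornerE -[X in _ == X]E /A /B; apply/eqP; ring.
Qed.

End unitary_simple.

(** * The collision resultant *)

Lemma sylvesterZ (R : comNzRingType) m n a (p q : {poly R}) :
  sylvester m n (a *: p) (a *: q) = a *: sylvester m n p q.
Proof.
rewrite /sylvester scale_col_mx.
by congr col_mx; apply/matrixP => i j; rewrite !mxE -scalerAr coefZ.
Qed.

Lemma disc_mxZ (R : comNzRingType) N a (x : {poly R}) :
  disc_mx N (a *: x) = a *: disc_mx N x.
Proof. by rewrite /disc_mx derivZ -scalerAr scalerMnr -scalerBr sylvesterZ. Qed.

Definition pencil_poly (R : comNzRingType) n (A B : 'M[R]_n) : {poly R} :=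
  \det ('X *: map_mx polyC A + map_mx polyC B).

Lemma horner_pencil_poly (R : comNzRingType) n (A B : 'M[R]_n) r :
  (pencil_poly A B).[r] = \det (r *: A + B).
Proof.
rewrite -horner_evalE /pencil_poly -det_map_mx; congr (\det _).
by apply/matrixP => i j; rewrite !mxE /= horner_evalE hornerD hornerM !hornerC hornerX.
Qed.

(** Factoring out A leaves a characteristic matrix, so no degree is lost. The exact size lets a
    Sylvester determinant detect common roots. *)
Lemma size_pencil_poly (F : fieldType) n (A B : 'M[F]_n) : \det A != 0 ->
  size (pencil_poly A B) = n.+1.
Proof.
move=> A0; have uA : A \in unitmx by rewrite unitmxE unitfE.
rewrite /pencil_poly (_ : _ + _ =
    map_mx polyC A *m char_poly_mx (- (invmx A *m B))); last first.
  rewrite /char_poly_mx map_mxN opprK mulmxDr -map_mxM mulKVmx//.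
  by rewrite mul_mx_scalar.
rewrite det_mulmx det_map_mx/= mul_polyC size_scale//.
exact: size_char_poly.
Qed.

Lemma pencil_polyZ (R : comNzRingType) n a (A B : 'M[R]_n) :
  pencil_poly (a *: A) (a *: B) = a ^+ n *: pencil_poly A B.
Proof.
rewrite /pencil_poly !map_mxZ scalerA mulrC -scalerA -scalerDr detZ.
by rewrite -mul_polyC rmorphXn.
Qed.

Section crossing.
Variables (C : numClosedFieldType) (N : nat).
Implicit Types (U : 'M[C]_N) (v : 'cV[C]_N).

Let M := (N.-1 + N.-1)%N.

(* For r <> 0 and |v| = 1, the eigenvalues of U (1 - r^-1 v v^* ) are the roots of
   r *: char_poly U + rank1_pert U v; the factor |v|^2 makes the discriminant of this
   polynomial homogeneous in v. *)
Definition disc_poly U v : {poly C} :=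
  pencil_poly ((v^t* *m v) 0 0 *: disc_mx N (char_poly U)) (disc_mx N (rank1_pert U v)).

(** The F(U, v) of the introduction. Unlike the existence of a real root of D, its vanishing is a
    polynomial equation in the real and imaginary parts of v. *)
Definition collision U v : C :=
  \det (sylvester M M (disc_poly U v) (map_poly Num.conj (disc_poly U v))).

(** Its nonvanishing rules out coincidences at distinct times. *)
Definition spectral_overlap U v : C := \det (sylvester N N (char_poly U) (rank1_pert U v)).

Lemma rank1_pertZ U a v : rank1_pert U (a *: v) = (a * a^*) *: rank1_pert U v.
Proof. by rewrite /rank1_pert trmxCZ -scalemxAr adjformZl adjformZr scalerA mulrC. Qed.

Lemma disc_polyZ U a v : disc_poly U (a *: v) = (a * a^*) ^+ M *: disc_poly U v.
Proof.
rewrite /disc_poly rank1_pertZ disc_mxZ -pencil_polyZ trmxCZ -scalemxAl -scalemxAr !scalerA.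
by rewrite mxE [a^* * a]mulrC.
Qed.

(** [disc_poly] scales by a power of |a|^2, which is real, so its conjugate scales by the same
    nonzero factor. *)
Lemma collisionZ U a v : a != 0 -> (collision U (a *: v) == 0) = (collision U v == 0).
Proof.
move=> a0; rewrite /collision disc_polyZ map_polyZ/=.
have -> : ((a * a^*) ^+ M)^* = (a * a^*) ^+ M.
  by rewrite rmorphXn rmorphM/= conjCK mulrC.
rewrite sylvesterZ detZ mulf_eq0 orb_idl// => /eqP E; exfalso; move/eqP: E; apply/negP.
by rewrite !expf_neq0// mulf_neq0// conjC_eq0.
Qed.

Lemma horner_disc_poly U v r :
  (disc_poly U v).[r] =
    \det (disc_mx N ((r * (v^t* *m v) 0 0) *: char_poly U + rank1_pert U v)).
Proof. by rewrite horner_pencil_poly scalerA disc_mx_linear. Qed.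

Section simple.
Variables (U : 'M[C]_N) (l : 'I_N -> C).
Hypotheses (N2 : (2 < N)%N).
Hypotheses (uU : U \is unitarymx) (cU : char_poly U = \prod_i ('X - (l i)%:P)).
Hypotheses (linj : injective l).

Let size_disc_poly v : (v^t* *m v) 0 0 = 1 -> size (disc_poly U v) = M.+1.
Proof.
move=> v1; rewrite size_pencil_poly// v1 scale1r.
by apply: disc_mx_char_poly_neq0 cU linj _; rewrite ltnW.
Qed.

(** The double root makes r a root of [disc_poly U v], and, r being real, of the conjugate
    polynomial too. *)
Lemma collision_eq0 v r z : (v^t* *m v) 0 0 = 1 -> r^* = r ->
  root (r *: char_poly U + rank1_pert U v) z ->
  root (r *: char_poly U + rank1_pert U v)^`() z -> collision U v = 0.
Proof.
move=> v1 rJ h1 h2; have sD := size_disc_poly v1.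
have r1 : root (disc_poly U v) r.
  apply/rootP; rewrite horner_disc_poly v1 mulr1; apply: disc_mx_double_root h1 h2.
    by rewrite ltnW.
  rewrite (leq_trans (size_polyD _ _))// geq_max (leq_trans (size_scale_leq _ _)).
    by rewrite (leq_trans (size_adjform _ _ _)).
  by rewrite size_char_poly.
apply: (sylvester_root (z := r)) => //; rewrite ?size_map_poly ?sD//.
  by rewrite /M; lia.
by rewrite rootE -rJ horner_map/= (rootP r1) rmorph0.
Qed.

(** A common root r of D and its conjugate makes D vanish at r and at r^* , which the direction from
    [exists_rank1_pert_simple] forbids. *)
Lemma exists_collision_neq0 : exists v, collision U v != 0.
Proof.
have [v v1 H] := exists_rank1_pert_simple uU cU linj N2; exists v; apply/eqP.
have sD := size_disc_poly v1.
move=> /sylvester_det0_root[]; rewrite ?size_map_poly ?sD ?eqxx// => r.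
move=> /andP[/rootP r1 /rootP r2].
apply: (H r); rewrite horner_disc_poly v1 mulr1 in r1; split=> //.
move: r2; rewrite -{1}[r]conjCK horner_map/= => /eqP; rewrite conjC_eq0 => /eqP.
by rewrite horner_disc_poly v1 mulr1.
Qed.

Lemma spectral_overlap_root v z : root (char_poly U) z -> root (rank1_pert U v) z ->
  spectral_overlap U v = 0.
Proof.
move=> h1 h2; apply: (sylvester_root (z := z)) => //; first by lia.
  by rewrite size_char_poly.
by rewrite leqW// size_adjform.
Qed.

Lemma spectral_overlap_eq0 v : spectral_overlap U v = 0 ->
  exists i, (rank1_pert U v).[l i] = 0.
Proof.
move=> /sylvester_det0_root[].
- by rewrite size_char_poly.
- by rewrite leqW// size_adjform.
- by rewrite size_char_poly eqxx.
move=> z /andP[]; rewrite cU rootE horner_prod.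
move=> /prodf_eq0[i _]; rewrite hornerXsubC subr_eq0 => /eqP -> /rootP ?.
by exists i.
Qed.

(** At a shared eigenvalue z, subtraction gives (a - b) q(z) = 0; if a <> b then p and q both vanish
    at z, a spectral overlap. If the two lists agree and i <> j, then z is a double root for the
    real parameter 1 / a, a collision. *)
Lemma no_crossing v (a b : C) (la lb : 'I_N -> C) :
  (v^t* *m v) 0 0 = 1 -> collision U v != 0 -> spectral_overlap U v != 0 ->
  a^* = a -> a != 0 ->
  char_poly U + a *: rank1_pert U v = \prod_i ('X - (la i)%:P) ->
  char_poly U + b *: rank1_pert U v = \prod_i ('X - (lb i)%:P) ->
  forall i j, la i = lb j -> a = b /\ (la =1 lb -> i = j).
Proof.
move=> v1 c0 o0 aJ a0 Ea Eb i j ij.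
have ra : (char_poly U + a *: rank1_pert U v).[la i] = 0.
  by rewrite Ea horner_prod; apply/eqP/prodf_eq0; exists i; rewrite // hornerXsubC subrr.
have rb : (char_poly U + b *: rank1_pert U v).[la i] = 0.
  by rewrite Eb horner_prod; apply/eqP/prodf_eq0; exists j; rewrite // hornerXsubC ij subrr.
split.
  apply/eqP; apply: contraNT o0 => ab; apply/eqP.
  have q0 : (rank1_pert U v).[la i] = 0.
    apply: (mulfI (_ : a - b != 0)); first by rewrite subr_eq0.
    by rewrite mulr0 -[RHS](subrr 0) -{1}ra -rb !hornerD !hornerZ; ring.
  apply: (@spectral_overlap_root _ (la i)); apply/rootP => //.
  by move: ra; rewrite hornerD hornerZ q0 mulr0 addr0.
move=> lab; apply/eqP; apply: contraNT c0 => nij; apply/eqP.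
have E : a^-1 *: char_poly U + rank1_pert U v = a^-1 *: \prod_i ('X - (la i)%:P).
  by rewrite -Ea scalerDr scalerA mulVf// scale1r.
apply: (@collision_eq0 v a^-1 (la i)) => //; first by rewrite fmorphV/= aJ.
  by rewrite E rootE hornerZ -Ea ra mulr0.
rewrite E (bigD1 i)//= (bigD1 j)//=; last by rewrite eq_sym.
rewrite -lab in ij.
rewrite -ij rootE derivZ hornerZ !derivM !derivXsubC !(hornerXsubC, hornerD, hornerM).
by rewrite subrr !(mul0r, mulr0, addr0).
Qed.

End simple.
End crossing.

(** * Polynomial expressions *)

Definition fun_subring (T : Type) (R : comNzRingType) (K : (T -> R) -> Prop) :=
  [/\ forall c, K (fun=> c),
      forall f g, K f -> K g -> K (fun t => f t + g t) &
      forall f g, K f -> K g -> K (fun t => f t * g t)].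

(* Every function of interest is a polynomial expression in matrix entries, so it
   belongs to any class of functions stable under ring operations. *)
Section fun_subring.
Variables (T : Type) (R : comNzRingType) (K : (T -> R) -> Prop).
Hypothesis Ksub : fun_subring K.

Lemma fun_subring_sum I (s : seq I) (P : pred I) (f : I -> T -> R) :
  (forall i, P i -> K (f i)) -> K (fun t => \sum_(i <- s | P i) f i t).
Proof.
have [K0 KD _] := Ksub => Kf; elim: s => [|i s IH].
  by under [X in K X]eq_fun do rewrite big_nil.
have [Pi|nPi] := boolP (P i); last first.
  by under [X in K X]eq_fun do rewrite big_cons (negbTE nPi).
under [X in K X]eq_fun do rewrite big_cons Pi.
by apply: KD => //; exact: Kf.
Qed.

Lemma fun_subring_prod I (s : seq I) (P : pred I) (f : I -> T -> R) :
  (forall i, P i -> K (f i)) -> K (fun t => \prod_(i <- s | P i) f i t).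
Proof.
have [K0 _ KM] := Ksub => Kf; elim: s => [|i s IH].
  by under [X in K X]eq_fun do rewrite big_nil.
have [Pi|nPi] := boolP (P i); last first.
  by under [X in K X]eq_fun do rewrite big_cons (negbTE nPi).
under [X in K X]eq_fun do rewrite big_cons Pi.
by apply: KM => //; exact: Kf.
Qed.

Lemma fun_subringZ a f : K f -> K (fun t => a * f t).
Proof. by have [K0 _ KM] := Ksub => Kf; apply: KM. Qed.

Lemma fun_subringMn n f : K f -> K (fun t => f t *+ n).
Proof.
move=> Kf; under [X in K X]eq_fun do rewrite -mulr_natl; exact: fun_subringZ.
Qed.

Lemma fun_subringB f g : K f -> K g -> K (fun t => f t - g t).
Proof.
have [_ KD _] := Ksub => Kf Kg; apply: KD => //.
under [X in K X]eq_fun do rewrite -mulN1r; exact: fun_subringZ.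
Qed.

Lemma fun_subring_det n (A : T -> 'M[R]_n) :
  (forall i j, K (fun t => A t i j)) -> K (fun t => \det (A t)).
Proof.
move=> KA; apply: fun_subring_sum => s _; apply: fun_subringZ.
by apply: fun_subring_prod => i _.
Qed.

Lemma fun_subring_adj n (A : T -> 'M[R]_n) :
  (forall i j, K (fun t => A t i j)) -> forall i j, K (fun t => (\adj (A t)) i j).
Proof.
move=> KA i j; under [X in K X]eq_fun do rewrite mxE.
apply: fun_subringZ; apply: fun_subring_det => i' j'.
by under [X in K X]eq_fun do rewrite !mxE.
Qed.

Lemma fun_subring_mul m n p (A : T -> 'M[R]_(m, n)) (B : T -> 'M[R]_(n, p)) :
  (forall i j, K (fun t => A t i j)) -> (forall i j, K (fun t => B t i j)) ->
  forall i j, K (fun t => (A t *m B t) i j).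
Proof.
have [_ _ KM] := Ksub => KA KB i j; under [X in K X]eq_fun do rewrite mxE.
by apply: fun_subring_sum => k _; apply: KM.
Qed.

Definition polyfun (f : T -> {poly R}) := forall k, K (fun t => (f t)`_k).

(** Polynomial-valued functions again form such a class, so the closure lemmas apply verbatim to
    determinants over [{poly R}]. *)
Lemma polyfun_subring : fun_subring polyfun.
Proof.
have [K0 KD KM] := Ksub; split=> [c k|f g Kf Kg k|f g Kf Kg k]; first exact: K0.
  by under [X in K X]eq_fun do rewrite coefD; exact: KD.
under [X in K X]eq_fun do rewrite coefM.
by apply: fun_subring_sum => i _; apply: KM.
Qed.

Lemma polyfunC f : K f -> polyfun (fun t => (f t)%:P).
Proof.
have [K0 _ _] := Ksub => Kf k; under [X in K X]eq_fun do rewrite coefC.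
by case: (k == 0%N).
Qed.

Lemma polyfun_deriv f : polyfun f -> polyfun (fun t => (f t)^`()).
Proof.
by move=> Kf k; under [X in K X]eq_fun do rewrite coef_deriv; exact: fun_subringMn.
Qed.

End fun_subring.

Section polynomial_expressions.
Variables (T : Type) (R : comNzRingType) (K : (T -> R) -> Prop).
Hypothesis Ksub : fun_subring K.

Let Psub := polyfun_subring Ksub.

Lemma fun_subring_sylvester m n (p q : T -> {poly R}) :
  polyfun K p -> polyfun K q -> forall i j, K (fun t => sylvester m n (p t) (q t) i j).
Proof.
move=> Kp Kq i j; under [X in K X]eq_fun do rewrite mxE.
by case: (fintype.split i) => k;
  under [X in K X]eq_fun do rewrite mxE; exact: (fun_subringZ Psub).
Qed.

Lemma fun_subring_disc_mx N (x : T -> {poly R}) :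
  polyfun K x -> forall i j, K (fun t => disc_mx N (x t) i j).
Proof.
move=> Kx; have Kdx := polyfun_deriv Ksub Kx.
apply: fun_subring_sylvester => //; apply: (fun_subringB Psub).
  exact: (fun_subringMn Psub).
exact: (fun_subringZ Psub).
Qed.

Lemma polyfun_pencil n (A B : T -> 'M[R]_n) :
  (forall i j, K (fun t => A t i j)) -> (forall i j, K (fun t => B t i j)) ->
  polyfun K (fun t => pencil_poly (A t) (B t)).
Proof.
have [_ PD _] := Psub => KA KB; apply: (fun_subring_det Psub) => i j.
under [X in polyfun K X]eq_fun do rewrite !mxE; apply: PD; last exact: polyfunC.
by apply: (fun_subringZ Psub); exact: polyfunC.
Qed.

Lemma polyfun_char_poly_mx n (A : T -> 'M[R]_n) :
  (forall i j, K (fun t => A t i j)) ->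
  forall i j, polyfun K (fun t => char_poly_mx (A t) i j).
Proof.
move=> KA i j; under [X in polyfun K X]eq_fun do rewrite !mxE.
have [P0 _ _] := Psub; apply: (fun_subringB Psub); first exact: P0.
exact: polyfunC.
Qed.

Lemma polyfun_char_poly n (A : T -> 'M[R]_n) :
  (forall i j, K (fun t => A t i j)) -> polyfun K (fun t => char_poly (A t)).
Proof.
by move=> KA; apply: (fun_subring_det Psub); exact: polyfun_char_poly_mx.
Qed.

Lemma polyfun_adjform n (A : T -> 'M[R]_n) (x : T -> 'rV_n) (y : T -> 'cV_n) :
  (forall i j, K (fun t => A t i j)) -> (forall i j, K (fun t => x t i j)) ->
  (forall i j, K (fun t => y t i j)) -> polyfun K (fun t => adjform (A t) (x t) (y t)).
Proof.
move=> KA Kx Ky; apply: (fun_subring_mul Psub) => [i j|i j]; last first.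
  by under [X in polyfun K X]eq_fun do rewrite !mxE; exact: polyfunC.
apply: (fun_subring_mul Psub) => [{}i {}j|].
  by under [X in polyfun K X]eq_fun do rewrite !mxE; exact: polyfunC.
by apply: (fun_subring_adj Psub); exact: polyfun_char_poly_mx.
Qed.

End polynomial_expressions.

Section collision_fun_subring.
Variables (T : Type) (C : numClosedFieldType) (N : nat) (K : (T -> C) -> Prop).
Hypotheses (Ksub : fun_subring K) (KJ : forall f, K f -> K (fun t => (f t)^*)).
Variables (U : T -> 'M[C]_N) (v : T -> 'cV[C]_N).
Hypotheses (KU : forall i j, K (fun t => U t i j)) (Kv : forall i j, K (fun t => v t i j)).

Let KvJ i j : K (fun t => ((v t)^t*) i j).
Proof. by under [X in K X]eq_fun do rewrite !mxE; exact: KJ. Qed.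

Let Krank1_pert : polyfun K (fun t => rank1_pert (U t) (v t)).
Proof. by apply: polyfun_adjform => //; exact: fun_subring_mul. Qed.

Lemma fun_subring_spectral_overlap : K (fun t => spectral_overlap (U t) (v t)).
Proof.
apply: fun_subring_det => //; apply: fun_subring_sylvester => //.
exact: polyfun_char_poly.
Qed.

Lemma fun_subring_collision : K (fun t => collision (U t) (v t)).
Proof.
have [_ _ KM] := Ksub.
have KD : polyfun K (fun t => disc_poly (U t) (v t)).
  apply: polyfun_pencil => // [i j|]; last exact: fun_subring_disc_mx.
  under [X in K X]eq_fun do rewrite mxE; apply: KM.
    by apply: fun_subring_mul.
  by apply: fun_subring_disc_mx => //; exact: polyfun_char_poly.
apply: fun_subring_det => //; apply: fun_subring_sylvester => // k.
by under [X in K X]eq_fun do rewrite coef_map; exact: KJ.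
Qed.

End collision_fun_subring.

Local Open Scope classical_set_scope.
Local Open Scope ring_scope.

(** * Zeros of polynomial functions are negligible *)

(** The measure of A is the integral of the measures of its sections, which vanish off a null
    set. *)
Lemma product_measure1_eq0 (R : realType) d1 d2 (T1 : measurableType d1)
    (T2 : measurableType d2) (m1 : {measure set T1 -> \bar R})
    (m2 : {sigma_finite_measure set T2 -> \bar R}) (A : set (T1 * T2)) (N : set T1) :
  measurable A -> measurable N -> m1 N = 0%E ->
  (forall x, ~ N x -> m2 (xsection A x) = 0%E) -> (m1 \x m2)%E A = 0%E.
Proof.
move=> mA mN N0 H; rewrite /product_measure1.
rewrite (@ge0_negligible_integral _ _ _ m1 setT N)//=; first last.
  exact: measurable_fun_xsection.
by rewrite integral0_eq// => x [_ /H].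
Qed.

Section polynomial_on.
Variables (R : realType) (T : Type) (L : (R -> T) -> Prop).

(** Polynomiality is asked along lines only, in a real parameter: this suffices to make zeros on a
    line finite, and it is stable under complex conjugation. *)
Definition polynomial_on (f : T -> R[i]) := forall g, L g ->
  exists P : {poly R[i]}, forall s : R, f (g s) = P.[s%:C%C].

Lemma polynomial_on_fun_subring : fun_subring polynomial_on.
Proof.
split=> [c g Lg|f h Pf Ph g Lg|f h Pf Ph g Lg]; first by exists c%:P => s; rewrite hornerC.
  have [[p pE] [q qE]] := (Pf g Lg, Ph g Lg).
  by exists (p + q) => s; rewrite hornerD pE qE.
have [[p pE] [q qE]] := (Pf g Lg, Ph g Lg).
by exists (p * q) => s; rewrite hornerM pE qE.
Qed.

Lemma polynomial_on_conj f : polynomial_on f -> polynomial_on (fun t => (f t)^*).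
Proof.
move=> Pf g Lg; have [p pE] := Pf g Lg.
exists (map_poly Num.conj p) => s.
rewrite pE -[in RHS](_ : (s%:C%C)^* = s%:C%C); first by rewrite horner_map.
exact: conjc_real.
Qed.

Lemma polynomial_on_zeros f g s0 : polynomial_on f -> L g -> f (g s0) != 0 ->
  finite_set [set s | f (g s) = 0].
Proof.
move=> Pf Lg; have [p pE] := Pf g Lg => fs0.
have p0 : p != 0 by apply: contra_neq fs0 => p0; rewrite pE p0 horner0.
have [rs rsE] : exists rs : seq R[i], forall z, p.[z] = 0 -> z \in rs.
  have [rs E] := closed_field_poly_normal p; exists rs => z.
  rewrite E hornerZ => /eqP; rewrite mulf_eq0 lead_coef_eq0 (negbTE p0)/=.
  by rewrite -rootE root_prod_XsubC.
apply: (@sub_finite_set _ _ [set` [seq complex.Re z | z <- rs]]); last exact: finite_seq.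
by move=> s /=; rewrite pE => /rsE zrs; apply/mapP; exists (s%:C%C).
Qed.

End polynomial_on.

(** * Measurability of complex-valued functions *)

Lemma measurable_complex_mul (R : realType) d (T : measurableType d) (f g : T -> R[i]) :
  measurable_fun setT f -> measurable_fun setT g -> measurable_fun setT (fun t => f t * g t).
Proof.
move=> /measurable_complexP[f1 f2] /measurable_complexP[g1 g2].
apply/measurable_complexP; split.
  rewrite (_ : _ \o _ = (fun t => complex.Re (f t) * complex.Re (g t) -
    complex.Im (f t) * complex.Im (g t))).
    by apply: measurable_funB; apply: measurable_funM.
  by apply/funext => t /=; case: (f t) (g t) => [a b] [a' b'].
rewrite (_ : _ \o _ = (fun t => complex.Re (f t) * complex.Im (g t) +
    complex.Im (f t) * complex.Re (g t))).
  by apply: measurable_funD; apply: measurable_funM.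
by apply/funext => t /=; case: (f t) (g t) => [a b] [a' b'].
Qed.

Lemma measurable_fun_subring (R : realType) d (T : measurableType d) :
  fun_subring (fun f : T -> R[i] => measurable_fun setT f).
Proof.
split=> [c|f g /measurable_complexP[f1 f2] /measurable_complexP[g1 g2]|f g].
- exact: measurable_cst.
- apply/measurable_complexP; split.
    rewrite (_ : _ \o _ = (fun t => complex.Re (f t) + complex.Re (g t))).
      exact: measurable_funD.
    by apply/funext => t /=; case: (f t) (g t) => [a b] [a' b'].
  rewrite (_ : _ \o _ = (fun t => complex.Im (f t) + complex.Im (g t))).
    exact: measurable_funD.
  by apply/funext => t /=; case: (f t) (g t) => [a b] [a' b'].
- exact: measurable_complex_mul.
Qed.

Lemma measurable_complex_conj (R : realType) d (T : measurableType d) (f : T -> R[i]) :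
  measurable_fun setT f -> measurable_fun setT (fun t => (f t)^*).
Proof.
move=> /measurable_complexP[f1 f2]; apply/measurable_complexP; split.
  rewrite (_ : _ \o _ = @complex.Re R \o f)//.
  by apply/funext => t /=; case: (f t).
rewrite (_ : _ \o _ = (fun t => - complex.Im (f t))); first exact: measurable_funN.
by apply/funext => t /=; case: (f t).
Qed.

Lemma measurable_complex_zeros (R : realType) d (T : measurableType d) (f : T -> R[i]) :
  measurable_fun setT f -> measurable [set t | f t = 0].
Proof.
move=> /measurable_complexP[f1 f2].
rewrite (_ : [set _ | _] = (@complex.Re R \o f) @^-1` [set 0] `&`
  (@complex.Im R \o f) @^-1` [set 0]).
  by apply: measurableI; rewrite -[X in measurable X]setTI; [exact: f1|exact: f2].
apply/seteqP; split => t /=; first by move=> ->.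
by case: (f t) => a b /= [-> ->].
Qed.

(** * Null zero sets in R^n, in C^n and on the sphere *)

Section lebesgue_zeros.
Variable R : realType.

(** The direction b may be zero: constant maps count as lines, so that some coordinates can be
    frozen. *)
Definition tuple_line n (g : R -> n.-tuple (measurableTypeR R)) : Prop :=
  exists a b : n.-tuple (measurableTypeR R),
    forall s j, tnth (g s) j = tnth a j + s * tnth b j.

Definition cvec_line n (g : R -> 'cV[R[i]]_n) : Prop :=
  exists a b : 'cV[R[i]]_n, forall s, g s = a + s%:C%C *: b.

(** Induction by Fubini: on the line through a along the first coordinate f has finitely many zeros,
    and for every other first coordinate the section is null by induction. *)
Lemma lebesgue_tuple_zeros n (f : n.-tuple (measurableTypeR R) -> R[i]) :
  measurable_fun setT f -> polynomial_on (@tuple_line n) f ->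
  (exists a, f a != 0) -> lebesgue_tuple n [set t | f t = 0] = 0%E.
Proof.
elim: n f => [|n IH] f mf Pf [a fa] /=.
  by rewrite diracE memNset//= => f0; move: fa; rewrite (tuple0 a) f0 eqxx.
rewrite /lebesgue_cons /image_measure /pushforward.
have mF := measurable_complex_zeros (measurableT_comp mf (@measurable_tuple_cons R n)).
pose b : n.-tuple (measurableTypeR R) := [tuple of behead a].
pose g (x : R) := tuple_cons ((x : measurableTypeR R), b).
have gl : tuple_line g.
  exists (tuple_cons (0 : measurableTypeR R, b)).
  exists (tuple_cons (1 : measurableTypeR R, [tuple (0 : measurableTypeR R) | _ < n])).
  move=> s j; case: (unliftP ord0 j) => [k ->|->].
    by rewrite !tnthS !tnth_mktuple mulr0 addr0.
  by rewrite !tnth0 mulr1 add0r.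
have fin : finite_set [set x : R | f (g x) = 0].
  apply: (polynomial_on_zeros (s0 := thead a) Pf gl).
  by rewrite /g /tuple_cons (_ : [tuple of _] = a)//; rewrite [RHS]tuple_eta; apply/val_inj.
apply: (@product_measure1_eq0 _ _ _ _ _ _ _ _
  [set x : measurableTypeR R | f (g x) = 0]) => //.
- apply: (measurable_complex_zeros (f := f \o g)); apply: (measurableT_comp mf).
  by apply: (measurableT_comp (@measurable_tuple_cons R n)); exact: pair2_measurable.
- exact/countable_lebesgue_measure0/finite_set_countable.
move=> x /= /eqP fx.
have -> : xsection (@tuple_cons R n @^-1` [set t | f t = 0]) x =
    [set t | (fun t => f (tuple_cons (x, t))) t = 0].
  by apply/seteqP; split => t; rewrite /xsection /= inE.
apply: IH; last by exists b.
  apply: (measurableT_comp mf); apply: (measurableT_comp (@measurable_tuple_cons R n)).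
  exact: pair1_measurable.
move=> h [c [e hE]]; apply: (Pf (fun s => tuple_cons (x, h s))).
exists (tuple_cons (x, c)), (tuple_cons (0 : measurableTypeR R, e)) => s j.
case: (unliftP ord0 j) => [k ->|->]; first by rewrite !tnthS -hE.
by rewrite !tnth0 mulr0 addr0.
Qed.

(** The same Fubini argument, with the real parts as first block and the imaginary parts as
    second. *)
Lemma lebesgue_cvec_zeros n (f : 'cV[R[i]]_n -> R[i]) :
  measurable_fun setT f -> polynomial_on (@cvec_line n) f ->
  (exists a, f a != 0) -> lebesgue_cvec [set x | f x = 0] = 0%E.
Proof.
move=> mf Pf [a fa].
rewrite /lebesgue_cvec /image_measure /pushforward.
pose F (p : n.-tuple (measurableTypeR R) * n.-tuple (measurableTypeR R)) :=
  f (cvec_of_ReIm p).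
have mF : measurable_fun setT F := measurableT_comp mf measurable_cvec_of_ReIm.
pose x0 : n.-tuple (measurableTypeR R) := [tuple complex.Re (a i 0) | i < n].
pose y0 : n.-tuple (measurableTypeR R) := [tuple complex.Im (a i 0) | i < n].
have F0 : F (x0, y0) != 0.
  rewrite /F (_ : cvec_of_ReIm _ = a)//; apply/colP => j.
  by rewrite mxE !tnth_mktuple; case: (a j 0).
have mx y : measurable_fun setT (fun x => F (x, y)).
  by apply: (measurableT_comp mF); exact: pair2_measurable.
have my x : measurable_fun setT (fun y => F (x, y)).
  by apply: (measurableT_comp mF); exact: pair1_measurable.
have line g h : tuple_line g -> tuple_line h -> cvec_line (fun s => cvec_of_ReIm (g s, h s)).
  move=> [c [e gE]] [c' [e' hE]]; exists (cvec_of_ReIm (c, c')), (cvec_of_ReIm (e, e')).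
  move=> s; apply/colP => j; rewrite !mxE /= gE hE; apply/eqP.
  by rewrite eq_complex /= !mul0r subr0 addr0 !eqxx.
have cst (t : n.-tuple (measurableTypeR R)) : tuple_line (fun=> t).
  exists t, [tuple (0 : measurableTypeR R) | _ < n] => s j.
  by rewrite tnth_mktuple mulr0 addr0.
have Px y : polynomial_on (@tuple_line n) (fun x => F (x, y)).
  by move=> g gl; apply: (Pf (fun s => cvec_of_ReIm (g s, y))); exact: line.
have Py x : polynomial_on (@tuple_line n) (fun y => F (x, y)).
  by move=> g gl; apply: (Pf (fun s => cvec_of_ReIm (x, g s))); exact: line.
apply: (@product_measure1_eq0 _ _ _ _ _ _ _ _ [set x | F (x, y0) = 0]) => //.
- exact: measurable_complex_zeros mF.
- exact: measurable_complex_zeros (mx _).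
- by apply: (lebesgue_tuple_zeros (mx y0) (Px y0)); exists x0.
move=> x /= /eqP Fx.
have -> : xsection (@cvec_of_ReIm R n @^-1` [set t | f t = 0]) x = [set y | F (x, y) = 0].
  by apply/seteqP; split => t; rewrite /xsection /= inE.
by apply: (lebesgue_tuple_zeros (my x) (Py x)); exists y0.
Qed.

Lemma enorm_eq0 n (x : 'cV[R[i]]_n) : enorm x = 0 -> x = 0.
Proof.
move=> /eqP; rewrite sqrtr_eq0 => S0.
have ge0 i : 0 <= complex.Re (x i 0) ^+ 2 + complex.Im (x i 0) ^+ 2.
  by rewrite addr_ge0 ?sqr_ge0.
have {S0} : \sum_i (complex.Re (x i 0) ^+ 2 + complex.Im (x i 0) ^+ 2) = 0.
  by apply/eqP; rewrite eq_le S0 sumr_ge0.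
move=> /psumr_eq0P H; apply/colP => j; rewrite mxE.
have /eqP := H (fun i _ => ge0 i) j isT.
rewrite paddr_eq0 ?sqr_ge0// !sqrf_eq0.
by case: (x j 0) => a b /= /andP[/eqP -> /eqP ->].
Qed.

(** By invariance under scaling, a point of the ball whose radial projection is a zero of f is
    itself a zero; the origin is its own projection. *)
Lemma uniform_sphere_zeros n (f : 'cV[R[i]]_n -> R[i]) :
  measurable_fun setT f -> polynomial_on (@cvec_line n) f ->
  (forall a x, a != 0 -> f (a *: x) = 0 -> f x = 0) ->
  (exists a, f a != 0) -> uniform_sphere [set x | f x = 0] = 0%E.
Proof.
move=> mf Pf fZ fa; rewrite uniform_sphereE (_ : lebesgue_cvec _ = 0%E) ?mul0e//.
have mA := measurable_complex_zeros mf.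
apply: (@subset_measure0 _ _ _ lebesgue_cvec _ _ _ mA _ (lebesgue_cvec_zeros mf Pf fa)).
  apply: measurableI; last exact: measurable_unit_ball.
  by rewrite -[X in measurable X]setTI; apply: measurable_radial_proj.
move=> x [/= fx _]; have [x0|x0] := eqVneq (enorm x) 0.
  by move: fx; rewrite /radial_proj (enorm_eq0 x0) scaler0.
apply: fZ fx; rewrite (_ : 0 = real_complex R 0)//.
by apply/negP => /eqP/(congr1 (@complex.Re R))/= /eqP; rewrite invr_eq0 (negbTE x0).
Qed.

Lemma sphere_density_eq0 n d (Omega : measurableType d) (P : probability Omega R)
    (v : {RV P >-> 'cV[R[i]]_n}) (A : set 'cV[R[i]]_n) :
  has_nonvanishing_sphere_density v -> measurable A ->
  uniform_sphere A = 0%E -> distribution P v A = 0%E.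
Proof.
move=> [f [mf _ vE]] mA A0; rewrite vE//.
have mAS : measurable (A `&` unit_sphere).
  by apply: measurableI => //; exact: measurable_unit_sphere.
apply: null_set_integral => //.
  apply: measurable_funS (measurableT_comp _ mf) => //.
  exact: measurable_unit_sphere.
apply: (@subset_measure0 _ _ _ uniform_sphere _ _ mAS mA _ A0).
exact: subIsetl.
Qed.

End lebesgue_zeros.

(** By independence the joint law agrees with the product law on rectangles, hence everywhere, and
    Fubini applies. *)
Lemma independent_RVs_negligible (R : realType) d (Omega : measurableType d)
    (P : probability Omega R) d1 d2 (T1 : measurableType d1) (T2 : measurableType d2)
    (X : {RV P >-> T1}) (Y : {RV P >-> T2}) (Z : set (T1 * T2)) :
  independent_RVs X Y -> measurable Z ->
  {ae P, forall w, distribution P Y (xsection Z (X w)) = 0%E} ->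
  P.-negligible [set w | Z (X w, Y w)].
Proof.
move=> indep mZ [N [mN N0 NE]].
have mXY : measurable_fun setT (fun w => (X w, Y w)) by exact: measurable_fun_pair.
pose XY : {mfun Omega >-> (T1 * T2)%type} := HB.pack (fun w => (X w, Y w))
  (isMeasurableFun.Build _ _ _ _ (fun w => (X w, Y w)) mXY).
have E : (distribution P X \x distribution P Y)%E Z = image_measure P XY Z.
  apply: product_measure_unique => // A B mA mB; exact: indep.
apply/negligibleP; first by rewrite -[X in measurable X]setTI; exact: (mXY).
have : image_measure P XY Z = 0%E; last by [].
rewrite -E.
(* The first coordinates with a non-null section; their preimage under X lies in the exceptional
   null set N. *)
pose N' := [set x | distribution P Y (xsection Z x) != 0%E].
have mN' : measurable N'.
  rewrite (_ : N' = setT `&` (distribution P Y \o xsection Z) @^-1` (~` [set 0%E])).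
    apply: measurable_fun_xsection => //.
    exact/measurableC/emeasurable_set1.
  rewrite setTI /N'; apply/seteqP; split => x /=; first by move/eqP.
  by move=> xN; apply/eqP.
apply: (@product_measure1_eq0 _ _ _ _ _ _ _ _ N') => //.
  apply: (subset_measure0 _ mN _ N0); first exact: measurable_funPTI.
  by move=> w /= /eqP wN; apply: NE => /=.
by move=> x /= /negP; rewrite negbK => /eqP.
Qed.

(** * The rank-one path, null sets for a fixed unitary matrix, and the conclusion *)

Lemma char_poly_rank_one_path (R : realType) n (U : 'M[R[i]]_n) (v : 'cV[R[i]]_n) t :
  char_poly (rank_one_path U v t) = char_poly U + (1 - t)%:C%C *: rank1_pert U v.
Proof.
rewrite /rank_one_path mulmxBr mulmx1 -scalemxAr mulmxA scalemxAr char_poly_rank1.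
by rewrite adjformZl.
Qed.

Lemma unit_sphere_trC (R : realType) n (v : 'cV[R[i]]_n) :
  unit_sphere v -> (v^t* *m v) 0 0 = 1.
Proof.
rewrite /unit_sphere /enorm /= => /(congr1 (fun x => x ^+ 2)); rewrite sqr_sqrtr; last first.
  by apply: sumr_ge0 => i _; rewrite addr_ge0 ?sqr_ge0.
rewrite expr1n => vE; rewrite mxE -[RHS](_ : real_complex R 1 = 1)// -vE rmorph_sum.
apply: eq_bigr => i _; rewrite !mxE; case: (v i 0) => a b; apply/eqP.
by rewrite eq_complex /= !expr2 mulNr opprK eqxx mulrC mulNr subrr eqxx.
Qed.

Section fixed_unitary.
Variables (R : realType) (N : nat) (U : 'M[R[i]]_N) (l : 'I_N -> R[i]).
Hypotheses (N2 : (2 < N)%N) (uU : U \is unitarymx) (linj : injective l).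
Hypothesis cU : char_poly U = \prod_i ('X - (l i)%:P).

Let mC := @measurable_fun_subring R _ 'cV[R[i]]_N.
Let pC := @polynomial_on_fun_subring R _ (@cvec_line R N).

Let p_entry i j : polynomial_on (@cvec_line R N) (fun x => x i j).
Proof.
move=> g [a [b gE]]; exists ((a i j)%:P + b i j *: 'X) => s.
by rewrite gE !mxE hornerD hornerC hornerZ hornerX mulrC.
Qed.

Lemma uniform_sphere_collision0 :
  uniform_sphere [set v | collision U v = 0] = 0%E.
Proof.
apply: uniform_sphere_zeros.
- apply: (fun_subring_collision mC) => [f|i j|i j].
  + exact: measurable_complex_conj.
  + exact: measurable_cst.
  + exact: measurable_mxE.
- apply: (fun_subring_collision pC) => [f|i j|i j]; first exact: polynomial_on_conj.
    by have [c _ _] := pC; exact: c.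
  exact: p_entry.
- by move=> a x a0 /eqP; rewrite collisionZ// => /eqP.
- exact: exists_collision_neq0 N2 uU cU linj.
Qed.

Let rank1_pert_horner (K : ('cV[R[i]]_N -> R[i]) -> Prop) z : fun_subring K ->
  (forall f, K f -> K (fun t => (f t)^*)) -> (forall i j, K (fun x => x i j)) ->
  K (fun v => (rank1_pert U v).[z]).
Proof.
move=> KC KJ Kx; have [K0 _ KM] := KC.
have Kp : polyfun K (fun v => rank1_pert U v).
  apply: polyfun_adjform => // i j.
    under [X in K X]eq_fun do rewrite !mxE; exact: KJ.
  by apply: fun_subring_mul => // *; exact: K0.
(* The size of q varies with v; evaluating as a sum of N terms gives a range independent of v. *)
under [X in K X]eq_fun do rewrite (horner_coef_wide _ (size_adjform _ _ _)).
by apply: fun_subring_sum => // i _; apply: KM => //; exact: Kp.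
Qed.

Lemma uniform_sphere_rank1_pert0 i :
  uniform_sphere [set v | (rank1_pert U v).[l i] = 0] = 0%E.
Proof.
apply: uniform_sphere_zeros.
- apply: (rank1_pert_horner _ mC) => [f|? ?]; first exact: measurable_complex_conj.
  exact: measurable_mxE.
- apply: (rank1_pert_horner _ pC) => [f|? ?]; first exact: polynomial_on_conj.
  exact: p_entry.
- move=> a x a0; rewrite rank1_pertZ hornerZ => /eqP.
  rewrite !mulf_eq0 conjC_eq0 (negbTE a0)/=.
  by move/eqP.
- exact: rank1_pert_neq0_at_eigenvalue uU cU linj i.
Qed.

(** A common root of p and q is one of the N eigenvalues of U, so the set is covered by the N null
    sets where q vanishes at a given eigenvalue. *)
Lemma uniform_sphere_spectral_overlap :
  uniform_sphere [set v | spectral_overlap U v = 0] = 0%E.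
Proof.
apply/negligibleP.
  apply: measurable_complex_zeros.
  apply: (fun_subring_spectral_overlap mC) => [f|i j|i j].
  + exact: measurable_complex_conj.
  + exact: measurable_cst.
  + exact: measurable_mxE.
apply: (@negligibleS _ _ _ _ (\big[setU/set0]_i [set v | (rank1_pert U v).[l i] = 0])).
  move=> v /= /(spectral_overlap_eq0 cU)[i vi]; rewrite -bigcup_seq.
  by exists i => //=; rewrite mem_index_enum.
elim/big_ind : _ => [|A B|i _]; [exact: negligible_set0|exact: negligibleU|].
apply/negligibleP; last exact: uniform_sphere_rank1_pert0.
apply: measurable_complex_zeros; apply: (rank1_pert_horner _ mC) => [f|? ?].
  exact: measurable_complex_conj.
exact: measurable_mxE.
Qed.

End fixed_unitary.

Theorem theorem3 (R : realType) (d : measure_display) (Omega : measurableType d)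
    (P : probability Omega R) (N : nat)
    (U : {RV P >-> 'M[R[i]]_N}) (v : {RV P >-> 'cV[R[i]]_N})
    (lambda : Omega -> R -> 'I_N -> R[i]) :
  (5 <= N)%N ->
  (forall w, U w \is unitarymx) ->
  {ae P, forall w, simple_spectrum (U w)} ->
  (forall w, unit_sphere (v w)) ->
  independent_RVs U v ->
  has_nonvanishing_sphere_density v ->
  (forall w t, -1 < t < 1 ->
     eigenvalues_of (rank_one_path (U w) (v w) t) (lambda w t)) ->
  P.-negligible [set w | exists (s t : R) (i j : 'I_N),
    [/\ -1 < s < 1, -1 < t < 1, (s, i) <> (t, j) &
        lambda w s i = lambda w t j]].
Proof.
move=> N5 uU sU v1 indep dens lamE.
have N2 : (2 < N)%N by exact: leq_trans N5.
pose T := ('M[R[i]]_N * 'cV[R[i]]_N)%type.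
(* Independence and the density reduce an almost sure statement on (U, v) to a null set on the
   sphere for each fixed U with simple spectrum. *)
have null (F : 'M[R[i]]_N -> 'cV[R[i]]_N -> R[i]) :
    measurable_fun [set: T] (fun p => F p.1 p.2) ->
    (forall u, u \is unitarymx -> simple_spectrum u ->
      uniform_sphere [set x | F u x = 0] = 0%E) ->
    P.-negligible [set w | F (U w) (v w) = 0].
  move=> mF F0; have mZ := measurable_complex_zeros mF.
  apply: (independent_RVs_negligible indep mZ).
  apply: filterS sU => w sUw.
  have xE : xsection [set p : T | F p.1 p.2 = 0] (U w) = [set x | F (U w) x = 0].
    by apply/seteqP; split => x; rewrite /xsection /= inE.
  rewrite xE; apply: sphere_density_eq0 => //; last exact: F0.
  by rewrite -xE; exact: measurable_xsection.
have mU i j : measurable_fun [set: T] (fun p => p.1 i j).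
  exact: (measurableT_comp (measurable_mxE i j) measurable_fst).
have mv i j : measurable_fun [set: T] (fun p => p.2 i j).
  exact: (measurableT_comp (measurable_mxE i j) measurable_snd).
have mS := @measurable_fun_subring R _ T.
have mJ := @measurable_complex_conj R _ T.
have nc : P.-negligible [set w | collision (U w) (v w) = 0].
  apply: null => [|u uu [l lE linj]]; first exact: fun_subring_collision.
  exact: (uniform_sphere_collision0 N2 uu linj lE).
have no : P.-negligible [set w | spectral_overlap (U w) (v w) = 0].
  apply: null => [|u uu [l lE linj]]; first exact: fun_subring_spectral_overlap.
  exact: (uniform_sphere_spectral_overlap uu linj lE).
have ns : P.-negligible [set w | ~ simple_spectrum (U w)] by exact: sU.
apply: negligibleS (negligibleU ns (negligibleU nc no)).
move=> w [s [t [i [j [s1 t1 ij lij]]]]]; apply: contrapT => H; apply: ij.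
have [[l lE linj]|nsw] := pselect (simple_spectrum (U w)); last by case: H; left.
have c0 : collision (U w) (v w) != 0 by apply/eqP => c0; apply: H; right; left.
have o0 : spectral_overlap (U w) (v w) != 0 by apply/eqP => o0; apply: H; right; right.
have path r : -1 < r < 1 -> char_poly (U w) + (1 - r)%:C%C *: rank1_pert (U w) (v w) =
    \prod_k ('X - (lambda w r k)%:P).
  by move=> r1; rewrite -char_poly_rank_one_path; exact: lamE.
have aJ : ((1 - s)%:C%C)^* = (1 - s)%:C%C by exact: conjc_real.
have a0 : (1 - s)%:C%C != 0.
  apply/eqP => /(congr1 (@complex.Re R))/= /eqP; rewrite subr_eq0 => /eqP s1E.
  by move: s1; rewrite -s1E ltxx andbF.
(* Here a = 1 - s, nonzero because s < 1, and b = 1 - t. Once s = t, both lists of eigenvalues are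
   the same function, so i = j. *)
have [st jE] := no_crossing N2 (uU w) lE linj (unit_sphere_trC (v1 w)) c0 o0 aJ a0
  (path _ s1) (path _ t1) lij.
have {}st : s = t by move: st => /(congr1 (@complex.Re R))/= /addrI/oppr_inj.
by rewrite -st in jE *; rewrite jE.
Qed.
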